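(* Let $k\in\mathbb{N}$ and $r\in\mathbb{N}_0$ be fixed. Let $f$ be integrable in $(0,\infty)$ and suppose that $f$ admits derivatives of orders $r+1$ and $r+2$ which are bounded (that is, exist and are finite) at a fixed point $x\in(0,\infty)$, and that $f^{(r)}(t)=O(t^{\alpha})$ as $t\to\infty$ for some $\alpha>0$. Then $$\lim_{n\to\infty} n\left(\frac{1}{b(n,k,r)}M_{n,k}^{(r)}(f;x)-f^{(r)}(x)\right)=(2r-k+1)\,x\,f^{(r+1)}(x)+x^{2}f^{(r+2)}(x).$$
   Context: $\mathbb{N}_0$ denotes the non-negative integers. For $n,k\in\mathbb{N}$ with $n\ge k$, the general Gamma type operators are $$M_{n,k}(f;x)=\frac{(2n-k+1)!\,x^{n+1}}{n!\,(n-k)!}\int_0^\infty \frac{t^{n-k}}{(x+t)^{2n-k+2}}f(t)\,dt,\qquad x>0.$$ $M_{n,k}^{(r)}(f;x)$ denotes the $r$-th derivative of $x\mapsto M_{n,k}(f;x)$ (with $M_{n,k}^{(0)}=M_{n,k}$). For $0\le r\le n$, $$b(n,k,r)=\frac{(n-r)!\,(n-k+r)!}{n!\,(n-k)!}.$$ *)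

(* Defs.v *)
From HB Require Import structures.
From mathcomp Require Import all_boot all_order all_algebra.
From mathcomp Require Import all_classical all_reals all_analysis.

Set Implicit Arguments.
Unset Strict Implicit.
Unset Printing Implicit Defensive.

Import Order.TTheory GRing.Theory Num.Theory.
Import numFieldNormedType.Exports.

Local Open Scope classical_set_scope.
Local Open Scope ring_scope.

(* For n < k the subtractions of natural numbers below are truncated;
   only k <= n is meaningful. *)
Definition gammaM (R : realType) (n k : nat) (f : R -> R) (x : R) : R :=
  ((2 * n - k + 1)`!)%:R * x ^+ n.+1 / ((n`!)%:R * ((n - k)`!)%:R) *
  \int[lebesgue_measure]_(t in `]0, +oo[)
    (t ^+ (n - k) / (x + t) ^+ (2 * n - k + 2) * f t).

(* Only k <= n and r <= n are meaningful. *)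
Definition bcoef (R : realType) (n k r : nat) : R :=
  ((n - r)`!)%:R * ((n - k + r)`!)%:R / ((n`!)%:R * ((n - k)`!)%:R).

(* [f] has a finite m-th derivative at [x].  The iterated derivative f^`(m) is
   a total operator with a default value where the derivative does not exist,
   so existence has to be stated separately; the derivative of order m.+1 at
   [x] requires the one of order m on a neighbourhood of [x]. *)
Fixpoint nderivable (R : realType) (m : nat) (f : R -> R) (x : R) : Prop :=
  if m is p.+1 then
    (\forall y \near x, nderivable p f y) /\ derivable (f^`(p)%classic) x 1
  else True.

(* Main.v *)
(* Write s = x / (x + t) and w = 1 - 2 s = (t - x) / (t + x).  Since the
   operator is an integral transform whose kernel is smooth in x,
   M_{n,k}^(r)(f; x) exists for every integrable f, and is the integral of f
   against the kernel times Q_{n,r}(s) / x^r, where the polynomials Q_{n,r}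
   satisfy Lorentz' bound |Q_{n,r}(s)| <= C (sqrt n + n |w|)^r.
   Split f into its Taylor polynomial P of degree r + 2 at x and a remainder g.
   On monomials M_{n,k} acts by t^j |-> b(n,k,j) x^j, and
   n (b(n,k,j) - 1) --> j (j - k), which yields the limit for P.  Near x,
   g(t) = o(|t - x|^(r+2)), so Lorentz' bound together with the moment estimate
   n^m E[w^(2m)] = O(1) makes n M_{n,k}^(r)(g; x) as small as desired; away from
   x the kernel decays faster than any power of n. *)

Require Import Defs.
From HB Require Import structures.
From mathcomp Require Import all_boot all_order all_algebra.
From mathcomp Require Import all_classical all_reals all_analysis.
From mathcomp Require Import ring lra zify.

Set Implicit Arguments.
Unset Strict Implicit.
Unset Printing Implicit Defensive.

Import Order.TTheory GRing.Theory Num.Theory.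
Import numFieldNormedType.Exports.

Local Open Scope classical_set_scope.
Local Open Scope ring_scope.

(** * Elementary estimates *)

(** The obstacle is the size of the r-th derivative. The kernel concentrates on |w| of order 1 /
    sqrt n, where n g has size o(n^(-r/2)), so the derivatives may cost n^(r/2) but not the trivial
    n^r. Lorentz' bound achieves this because n + 1 - (2n - k + 2) s = n w + O(1): up to bounded
    terms a derivative produces a factor n w, small where the mass is, and a later derivative that
    removes such a w leaves one factor n for two derivatives. Deviations are measured by w and not
    by t - x: |w| is at most 1, so all its moments exist for every n, and in the variable s the
    kernel is, up to its constant, s^k times the symmetric Beta density (s (1 - s))^(n-k), whose
    even moments in w are explicit products. Since f^(r+2) is known only at x, the remainder is
    controlled in Peano's form, and all derivatives fall on the kernel. While f is integrable, P in
    general is not; both are handled in the class of functions integrable against (1 + t)^(-L). *)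

Lemma expr_mul_onem_le (R : realFieldType) (v : R) (m q : nat) :
  0 <= v <= 1 -> v ^+ m * (1 - v) ^+ q <= (m`!)%:R / q.+1%:R ^+ m.
Proof.
move=> /andP[v0 v1]; rewrite ler_pdivlMr ?exprn_gt0//.
have nneg i : 0 <= (1 - v) ^+ (q + m - i) * v ^+ i *+ 'C(q + m, i).
  by rewrite mulrn_wge0// mulr_ge0// exprn_ge0// subr_ge0.
(* The left-hand side is one term of the binomial expansion of ((1 - v) + v)^(q + m) = 1. *)
have bin_le : v ^+ m * (1 - v) ^+ q *+ 'C(q + m, m) <= 1.
  have := exprDn (1 - v) v (q + m); rewrite subrK expr1n => e.
  rewrite [leRHS]e.
  have mlt : (m < (q + m).+1)%N by rewrite ltnS leq_addl.
  rewrite (bigD1 (Ordinal mlt))//= addnK (mulrC (v ^+ m)) lerDl.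
  exact: sumr_ge0.
(* The product is the falling factorial of q + m of length m, all of whose factors are at least q +
   1. *)
have le_bin : q.+1%:R ^+ m <= ('C(q + m, m) * m`!)%:R :> R.
  rewrite bin_ffact -natrX ler_nat.
  elim: m {nneg bin_le} => [|m ih]; first by rewrite expn0 ffactn0.
  by rewrite addnS ffactnS succnK expnS leq_mul// ltnS leq_addr.
apply: (le_trans (ler_wpM2l _ le_bin)).
  by rewrite mulr_ge0// exprn_ge0// subr_ge0.
by rewrite natrM mulrA -[leRHS]mul1r ler_wpM2r ?mulr_natr.
Qed.

Definition gamma_cst (R : realType) (n k : nat) : R :=
  ((2 * n - k + 1)`!)%:R / ((n`!)%:R * ((n - k)`!)%:R).

Lemma factR_neq0 (R : numDomainType) n : (n`!)%:R != 0 :> R.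
Proof. by rewrite pnatr_eq0 -lt0n fact_gt0. Qed.

Lemma gamma_cst_ge0 (R : realType) n k : 0 <= gamma_cst R n k.
Proof. by rewrite /gamma_cst divr_ge0// mulr_ge0. Qed.

(** The constant equals 2n - k + 1 times a binomial coefficient of 2n - k. *)
Lemma gamma_cst_le (R : realType) n k : (k <= n)%N ->
  gamma_cst R n k <= (2 * n - k + 1)%:R * 2 ^+ (2 * n - k).
Proof.
move=> kn; rewrite /gamma_cst ler_pdivrMr ?mulr_gt0 ?ltr0n ?fact_gt0//.
have ->: (2 * n - k = n + (n - k))%N by lia.
rewrite addn1 factS -(@bin_fact (n + (n - k)) n) ?leq_addr// addKn.
rewrite -natrX -!natrM ler_nat -[leqRHS]mulnA leq_mul2l leq_mul2r.
apply/orP; right; apply/orP; right.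
rewrite -[X in (X ^ _)%N](_ : 1 + 1 = 2)%N// Pascal (bigD1 (inord n))//=.
rewrite inordK ?ltnS ?leq_addr// !exp1n !muln1; exact: leq_addr.
Qed.

(** The left-hand side is the product of (2p + 1 + i) / (p + i) for i from 1 to k, each factor at
    most 2. The fraction p!^2 / (2p + 1)! is the total mass of [sym_kernel], so this bounds the loss
    when the kernel is replaced by its symmetric version. *)
Lemma gamma_cst_sym (R : realType) p k :
  gamma_cst R (p + k) k * ((p`!)%:R ^+ 2 / ((2 * p + 1)`!)%:R) <= 2 ^+ k.
Proof.
have fne m := factR_neq0 R m.
rewrite /gamma_cst addnK (_ : 2 * (p + k) - k + 1 = 2 * p + 1 + k)%N; last lia.
elim: k => [|k ih].
  by rewrite !addn0 expr0 expr2 le_eqVlt; apply/orP/or_introl/eqP; field;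
    rewrite !fne.
rewrite (exprS 2 k) (addnS p) (addnS (2 * p + 1)) (factS (p + k)).
rewrite (factS (2 * p + 1 + k)) !natrM.
set a := ((2 * p + 1 + k).+1%:R : R); set b := ((p + k).+1%:R : R).
have b0 : 0 < b by rewrite ltr0n.
have -> : a * ((2 * p + 1 + k)`!)%:R / (b * ((p + k)`!)%:R * (p`!)%:R) *
    ((p`!)%:R ^+ 2 / ((2 * p + 1)`!)%:R) = a / b *
    (((2 * p + 1 + k)`!)%:R / (((p + k)`!)%:R * (p`!)%:R) *
    ((p`!)%:R ^+ 2 / ((2 * p + 1)`!)%:R)) :> R.
  by field; rewrite !fne gt_eqF.
apply: ler_pM => //.
- by rewrite divr_ge0.
- by rewrite ler_pdivrMr// -natrM ler_nat; lia.
Qed.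

(** * Lorentz polynomials *)

(* y ^+ r times the r-th derivative in y of y ^+ a / (y + t) ^+ N is
   y ^+ a / (y + t) ^+ N times this polynomial evaluated at y / (y + t). *)
Fixpoint kernel_poly (R : realType) (a N r : nat) : {poly R} :=
  if r is r'.+1 then
    (a%:R - r'%:R - N%:R *: 'X) * kernel_poly R a N r' +
    'X * (1 - 'X) * (kernel_poly R a N r')^`()
  else 1.

(* Families of polynomials of weight at most d, where n has weight 2 and
   n (1 - 2 X) has weight 1.  The class is syntactic, so that it can be seen
   to be stable under differentiation, which costs one unit of weight. *)
Inductive lorentz (R : realType) (k : nat) : nat -> (nat -> {poly R}) -> Prop :=
| lorentz_cst d p : lorentz k d (fun=> p)
| lorentz_scale d Q : lorentz k d Q -> lorentz k d.+2 (fun n => n%:R *: Q n)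
| lorentz_onem2 d Q : lorentz k d Q ->
    lorentz k d.+1 (fun n => n%:R *: ((1 - 2 *: 'X) * Q n))
| lorentz_add d Q1 Q2 : lorentz k d Q1 -> lorentz k d Q2 ->
    lorentz k d (fun n => Q1 n + Q2 n)
| lorentz_mul d p Q : lorentz k d Q -> lorentz k d (fun n => p * Q n)
| lorentz_weak d Q : lorentz k d Q -> lorentz k d.+1 Q
| lorentz_ext d Q1 Q2 : (forall n, (k <= n)%N -> Q1 n = Q2 n) ->
    lorentz k d Q1 -> lorentz k d Q2.

(** The decisive case is n (1 - 2 X) Q: differentiating 1 - 2 X destroys a factor of weight one but
    leaves n, of weight two, so the total grows by exactly one. *)
Lemma lorentz_deriv (R : realType) k d (Q : nat -> {poly R}) :
  lorentz k d Q -> lorentz k d.+1 (fun n => (Q n)^`()).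
Proof.
elim=> {d Q} [d p|d Q lQ ih|d Q lQ ih|d Q1 Q2 _ ih1 _ ih2|d p Q lQ ih|d Q _ ih|
  d Q1 Q2 Q12 _ ih].
- exact: lorentz_cst.
- apply: lorentz_ext (lorentz_scale ih) => n _; exact/esym/derivZ.
- apply: (lorentz_ext _ (lorentz_add
    (lorentz_mul (- 2) (lorentz_scale lQ)) (lorentz_onem2 ih))) => n _.
  rewrite derivZ derivM derivB derivZ derivX derivC sub0r scalerDr.
  by congr (_ + _); rewrite -scalerAr scaler_nat -mulNrn.
- apply: lorentz_ext (lorentz_add ih1 ih2) => n _; exact/esym/derivD.
- apply: lorentz_ext (lorentz_add (lorentz_mul p^`() (lorentz_weak lQ))
    (lorentz_mul p ih)) => n _; exact/esym/derivM.
- exact: lorentz_weak.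
- by apply: lorentz_ext ih => n kn; rewrite Q12.
Qed.

(** With a = n + 1 and N = 2n - k + 2 the multiplier a - r - N X is n (1 - 2 X) plus a polynomial
    free of n. Hence both terms of the recursion raise the weight by one. The restriction k <= n
    makes the truncated subtraction in N exact. *)
Lemma kernel_poly_lorentz (R : realType) k r :
  lorentz k r (fun n => kernel_poly R n.+1 (2 * n - k + 2) r).
Proof.
elim: r => [|r ih] /=; first exact: lorentz_cst.
apply: lorentz_ext (lorentz_add (lorentz_add (lorentz_onem2 ih)
  (lorentz_weak (lorentz_mul ((1 - r%:R) + (k%:R - 2) *: 'X) ih)))
  (lorentz_mul ('X * (1 - 'X)) (lorentz_deriv ih))) => n kn.
congr (_ + _); rewrite scalerAl -mulrDl; congr (_ * _).
rewrite natrD natrB ?natrM; last lia.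
rewrite -!mul_polyC !(rmorphD, rmorphB, rmorphM, rmorph_nat) /= -[n.+1]addn1 natrD.
ring.
Qed.

Lemma horner_bounded01 (R : realType) (p : {poly R}) :
  exists2 C : R, 0 <= C & forall s : R, 0 <= s <= 1 -> `|p.[s]| <= C.
Proof.
exists (\sum_(i < size p) `|p`_i|); first exact: sumr_ge0.
move=> s /andP[s0 s1]; rewrite horner_coef.
apply: le_trans (ler_norm_sum _ _ _) _; apply: ler_sum => i _.
by rewrite normrM ler_piMr// ger0_norm ?exprn_ge0// exprn_ile1.
Qed.

(** For B = sqrt n + n |1 - 2 s| one has n <= B^2, n |1 - 2 s| <= B and 1 <= B, which match the
    weights two, one and zero of the constructors. *)
Lemma lorentz_bound (R : realType) k d (Q : nat -> {poly R}) :
  lorentz k d Q -> exists2 C : R, 0 <= C & forall n s, (0 < n)%N -> (k <= n)%N ->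
    0 <= s <= 1 ->
    `|(Q n).[s]| <= C * (Num.sqrt n%:R + n%:R * `|1 - 2 * s|) ^+ d.
Proof.
pose B (n : nat) (s : R) := Num.sqrt n%:R + n%:R * `|1 - 2 * s|.
have B1 n s : (0 < n)%N -> 1 <= B n s.
  move=> n0; rewrite ler_wpDr ?mulr_ge0//.
  by have := @ler_wsqrtr R 1 n%:R; rewrite sqrtr1 ler1n => /(_ n0).
have B0 n s : 0 <= B n s by rewrite addr_ge0 ?sqrtr_ge0// mulr_ge0.
elim=> {d Q} [d p|d Q _ [C C0 hC]|d Q _ [C C0 hC]|
  d Q1 Q2 _ [C1 C10 hC1] _ [C2 C20 hC2]|d p Q _ [C C0 hC]|d Q _ [C C0 hC]|
  d Q1 Q2 Q12 _ [C C0 hC]].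
- have [C C0 hC] := horner_bounded01 p; exists C => // n s n0 kn s01.
  by rewrite (le_trans (hC _ s01))// ler_peMr// exprn_ege1// B1.
- exists C => // n s n0 kn s01; rewrite hornerZ normrM -/(B n s).
  rewrite -addn2 exprD mulrA mulrC ler_pM//; first exact: hC.
  rewrite ger0_norm// -[leLHS](sqr_sqrtr (ler0n _ n)).
  by rewrite lerXn2r ?nnegrE ?sqrtr_ge0 ?B0// lerDl mulr_ge0.
- exists C => // n s n0 kn s01; rewrite hornerZ hornerM -/(B n s).
  rewrite mulrA normrM exprSr mulrA mulrC ler_pM//; first exact: hC.
  by rewrite !hornerE normrM ger0_norm// lerDr sqrtr_ge0.
- exists (C1 + C2); first exact: addr_ge0.
  move=> n s n0 kn s01; rewrite hornerD mulrDl.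
  by rewrite (le_trans (ler_normD _ _))// lerD ?hC1 ?hC2.
- have [C' C'0 hC'] := horner_bounded01 p.
  exists (C' * C); first exact: mulr_ge0.
  move=> n s n0 kn s01; rewrite hornerM normrM -mulrA ler_pM ?hC//.
  exact: hC'.
- exists C => // n s n0 kn s01; rewrite (le_trans (hC _ _ n0 kn s01))//.
  by rewrite -/(B n s) ler_wpM2l// exprS ler_peMl ?B1 ?exprn_ge0.
- by exists C => // n s n0 kn s01; rewrite -Q12// hC.
Qed.

(** * Differentiation under the integral sign *)

Section kernel.
Variable R : realType.
Implicit Types (y t : R) (Q : {poly R}).

Lemma is_derive1M (f g : R -> R) (y df dg : R) :
  is_derive y (1 : R) f df -> is_derive y (1 : R) g dg ->
  is_derive y (1 : R) (fun z => f z * g z) (f y * dg + g y * df).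
Proof. by move=> ? ?; apply: is_deriveM. Qed.

(** Writing n f^n / f instead of n f^(n-1) avoids a truncated predecessor and leaves an expression
    that [field] can treat. *)
Lemma is_derive1X (f : R -> R) n (y df : R) : f y != 0 ->
  is_derive y (1 : R) f df -> is_derive y (1 : R) (fun z => f z ^+ n)
    (n%:R * f y ^+ n / f y * df).
Proof.
move=> fy0 dfy; have -> : n%:R * f y ^+ n / f y = n%:R * f y ^+ n.-1.
  by case: n => [|n]; rewrite ?mul0r//= exprS -!mulrA (mulrC (f y)) mulfVK.
have -> : (fun z => f z ^+ n) = f ^+ n by apply/funext => z; rewrite fctE.
exact: is_deriveX.
Qed.

Lemma is_derive1V (f : R -> R) (y df : R) : f y != 0 ->
  is_derive y (1 : R) f df -> is_derive y (1 : R) (fun z => (f z)^-1)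
    (- (f y)^-1 / f y * df).
Proof.
move=> fy0 dfy; apply: (trigger_derive (is_deriveV fy0 dfy)).
by rewrite /GRing.scale/= expr2 invfM !mulNr.
Qed.

(* The exponents of y are kept apart because a - r may be negative. *)
Definition kern (a r N : nat) Q y t :=
  y ^+ a / y ^+ r / (y + t) ^+ N * Q.[y / (y + t)].

Lemma kern1E N y t : kern 0 0 N 1 y t = ((y + t) ^+ N)^-1.
Proof. by rewrite /kern !expr0 hornerC divr1 mul1r mulr1. Qed.

(** For s = y / (y + t) one has y s' = s (1 - s), and the logarithmic derivative of the prefactor,
    multiplied by y, is a - r - N s. So t enters the derivative only through s and the same
    prefactor, and the family [kern] is closed under differentiation. *)
Lemma is_derive_kern a r N Q y t : y != 0 -> y + t != 0 ->
  is_derive y (1 : R) (fun z => kern a r N Q z t)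
    (kern a r.+1 N ((a%:R - r%:R - N%:R *: 'X) * Q + 'X * (1 - 'X) * Q^`()) y t).
Proof.
move=> y0 yt0.
have did : is_derive y (1 : R) (fun z : R => z) 1 by exact: is_derive_id.
have dadd : is_derive y (1 : R) (fun z : R => z + t) 1.
  rewrite -[X in is_derive _ _ _ X]addr0.
  by apply: (@is_deriveD _ _ _ id (cst t)).
have dX n := @is_derive1X (fun z => z) n _ _ y0 did.
have dV n := @is_derive1V (fun z => z ^+ n) _ _ (expf_neq0 n y0) (dX n).
have daV n := @is_derive1V (fun z => (z + t) ^+ n) _ _ (expf_neq0 n yt0)
  (@is_derive1X (fun z => z + t) n _ _ yt0 dadd).
have ds := is_derive1M did (@is_derive1V (fun z => z + t) _ _ yt0 dadd).
have dQ : is_derive y (1 : R) (fun z => Q.[z / (z + t)])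
    (Q^`().[y / (y + t)] * (y * (- (y + t)^-1 / (y + t) * 1) + (y + t)^-1 * 1)).
  exact: (is_derive1_comp (is_derive_poly _ _) ds).
have dall := is_derive1M (is_derive1M (is_derive1M (dX a) (dV r)) (daV N)) dQ.
apply: (trigger_derive dall).
rewrite /kern !(hornerE, hornerMn) /=.
rewrite exprSr.
have := expf_neq0 a y0; have := expf_neq0 r y0; have := expf_neq0 N yt0.
move: (y ^+ a) (y ^+ r) ((y + t) ^+ N) => ya yr ytN ytN0 yr0 ya0.
by field; rewrite y0 yt0 yr0 ytN0.
Qed.

Local Notation mu := (@lebesgue_measure R).
Local Notation D := (`]0%R, +oo[%classic : set R).

Lemma in_D t : D t -> 0 < t.
Proof. by rewrite /= in_itv/= andbT. Qed.

Lemma kern_continuous a r N Q y t : y + t != 0 -> {for t, continuous (kern a r N Q y)}.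
Proof.
move=> yt0; rewrite /prop_for /kern.
have cadd : y + z @[z --> t] --> y + t.
  by apply: cvgD; [exact: cvg_cst|exact: cvg_id].
apply: cvgM.
  apply: cvgM; first exact: cvg_cst.
  apply: cvgV; first exact: expf_neq0.
  by apply: (@continuous_cvg _ _ _ _ _ _ (fun z : R => z ^+ N)) => //; exact: exprn_continuous.
apply: (@continuous_cvg _ _ _ _ _ _ (horner Q)); first exact: continuous_horner.
by apply: cvgM; [exact: cvg_cst|exact: cvgV].
Qed.

Lemma kern_measurable a r N Q y : 0 < y -> measurable_fun D (kern a r N Q y).
Proof.
move=> y0; apply: measurable_realfun.open_continuous_measurable_fun;
  first exact: interval_open.
move=> t; rewrite inE => /in_D t0; apply: kern_continuous.
by rewrite gt_eqF// addr_gt0.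
Qed.

Lemma onem_itv01 y t : 0 < y -> 0 < t -> 0 <= y / (y + t) <= 1.
Proof.
move=> y0 t0; have yt0 := addr_gt0 y0 t0.
by rewrite divr_ge0 ?(ltW y0) ?(ltW yt0)//= ler_pdivrMr// mul1r lerDl ltW.
Qed.

Lemma kern_bound a r N Q (u v : R) : 0 < u -> exists2 C : R, 0 <= C &
  forall y t, u <= y <= v -> 0 < t -> `|kern a r N Q y t| <= C / (1 + t) ^+ N.
Proof.
move=> u0; have [B B0 hB] := horner_bounded01 Q.
exists (`|v| ^+ a / u ^+ r * (1 + u^-1) ^+ N * B).
  by rewrite !mulr_ge0 ?exprn_ge0// ?invr_ge0 ?exprn_ge0 ?addr_ge0 ?invr_ge0// ltW.
move=> y t /andP[uy yv] t0; have y0 := lt_le_trans u0 uy.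
have yt0 := addr_gt0 y0 t0; have t10 : 0 < 1 + t by rewrite addr_gt0.
have hpow : y ^+ a / y ^+ r <= `|v| ^+ a / u ^+ r.
  apply: ler_pM; rewrite ?invr_ge0 ?exprn_ge0 ?(ltW y0)//.
    by rewrite lerXn2r ?nnegrE ?(ltW y0)// (le_trans yv)// ler_norm.
  by rewrite lef_pV2 ?posrE ?exprn_gt0// lerXn2r ?nnegrE ?(ltW y0) ?(ltW u0).
(* This reduces to 1 + t <= (1 + 1/u) (y + t), which holds as soon as u <= y. *)
have hshift : ((y + t) ^+ N)^-1 <= (1 + u^-1) ^+ N / (1 + t) ^+ N.
  rewrite -!exprVn -exprMn lerXn2r ?nnegrE ?invr_ge0 ?(ltW yt0)//.
    by rewrite mulr_ge0 ?addr_ge0 ?invr_ge0 ?(ltW u0) ?(ltW t10).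
  rewrite ler_pdivlMr// mulrC ler_pdivrMr// mulrDl mul1r addrC.
  have : u^-1 * u <= u^-1 * (y + t).
    by rewrite ler_wpM2l ?invr_ge0 ?(ltW u0)// (le_trans uy)// lerDl ltW.
  rewrite mulVf ?gt_eqF//; have := ltW y0; lra.
have -> : `|v| ^+ a / u ^+ r * (1 + u^-1) ^+ N * B / (1 + t) ^+ N =
    `|v| ^+ a / u ^+ r * ((1 + u^-1) ^+ N / (1 + t) ^+ N) * B by ring.
rewrite /kern normrM; apply: ler_pM; rewrite ?hB ?onem_itv01//.
have ge0 : 0 <= y ^+ a / y ^+ r by rewrite divr_ge0 ?exprn_ge0 ?(ltW y0).
have ge0' : 0 <= ((y + t) ^+ N)^-1 by rewrite invr_ge0 exprn_ge0 ?(ltW yt0).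
by rewrite ger0_norm; [exact: ler_pM|exact: mulr_ge0].
Qed.

Lemma eq_integrable_D (f g : R -> R) : (forall t, 0 < t -> f t = g t) ->
  mu.-integrable D (EFin \o f) -> mu.-integrable D (EFin \o g).
Proof.
move=> fg; apply: (@eq_integrable _ _ R mu D (measurable_itv _)).
by move=> t; rewrite inE => /in_D t0 /=; rewrite fg.
Qed.

Lemma integrable_bounded_mul (u h : R -> R) C : measurable_fun D u ->
  (forall t, 0 < t -> `|u t| <= C) -> mu.-integrable D (EFin \o h) ->
  mu.-integrable D (EFin \o (fun t => u t * h t)).
Proof.
move=> mu_ uC ih.
have bu : [bounded u t | t in D].
  by exists C; split=> [|M CM t /in_D t0];
    rewrite ?num_real//= (le_trans (uC _ t0))// ltW.
apply: (@eq_integrable_D (u \* h)) => //.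
exact: (@integrableMr _ _ R mu D (measurable_itv _) u (EFin \o h) mu_ bu ih).
Qed.

(** The weight is (1 + t)^(-L) and not (x + t)^(-L), so that the class is the same for all points at
    which the kernel is taken. *)
Definition wint (L : nat) (h : R -> R) :=
  mu.-integrable D (EFin \o (fun t => h t / (1 + t) ^+ L)).

Lemma measurable_1t n : measurable_fun D (fun t : R => (1 + t) ^+ n).
Proof.
apply: measurable_realfun.measurable_funX.
apply: measurable_realfun.measurable_funD; first exact: measurable_cst.
exact: measurable_id.
Qed.

Lemma kern_integrable a r N Q y h : 0 < y -> wint N h ->
  mu.-integrable D (EFin \o (fun t => kern a r N Q y t * h t)).
Proof.
move=> y0 ih; have [C C0 hC] := @kern_bound a r N Q y y y0.
have mu_ : measurable_fun D (fun t => kern a r N Q y t * (1 + t) ^+ N).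
  by apply: measurable_realfun.measurable_funM; [exact: kern_measurable|exact: measurable_1t].
apply: (eq_integrable_D _ (integrable_bounded_mul (C := C) mu_ _ ih)).
- move=> t t0.
  have tN0 : (1 + t) ^+ N != 0 by rewrite expf_neq0// gt_eqF// addr_gt0.
  by rewrite -mulrA [_ ^+ N * _]mulrC divfK.
- move=> t t0; rewrite normrM -ler_pdivlMr ?normr_gt0 ?expf_neq0 ?gt_eqF ?addr_gt0//.
  by rewrite [X in _ / X]ger0_norm ?exprn_ge0 ?addr_ge0 ?(ltW t0)// hC// lexx.
Qed.

(** The derivative of the kernel is again a kernel, so [kern_bound] on the interval from y / 2 to 2
    y, which stays away from 0, supplies the dominating function C |h| / (1 + t)^N. *)
Lemma is_derive_Rint_kern a r N Q h y : 0 < y -> wint N h ->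
  is_derive y (1 : R) (fun z => \int[mu]_(t in D) (kern a r N Q z t * h t))
    (\int[mu]_(t in D) (kern a r.+1 N ((a%:R - r%:R - N%:R *: 'X) * Q +
       'X * (1 - 'X) * Q^`()) y t * h t)).
Proof.
move=> y0 ih; set Q1 := (X in kern a r.+1 N X).
have y20 : 0 < y / 2 by rewrite divr_gt0.
have [C C0 hC] := @kern_bound a r.+1 N Q1 (y / 2) (2 * y) y20.
pose G (t : R) := C * `|h t / (1 + t) ^+ N|.
have iG : mu.-integrable D (EFin \o G).
  apply: (eq_integrable_D _ (integrable_bounded_mul (u := cst C) (C := C) _ _
    (integrable_norm ih))) => // t t0; rewrite /= ger0_norm//.
pose F (z t : R) := kern a r N Q z t * h t.
have in_I (z : R) : `](y / 2), (2 * y)[%classic z -> [/\ 0 < z, y / 2 <= z & z <= 2 * y].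
  by rewrite /= in_itv/= => /andP[z1 z2]; split; rewrite ?ltW// (lt_trans y20).
have dF (z t : R) : 0 < z -> 0 < t ->
    is_derive z (1 : R) (F ^~ t) (kern a r.+1 N Q1 z t * h t).
  move=> z0 t0; have zt0 := addr_gt0 z0 t0.
  have := is_derive1M (is_derive_kern a r N Q (lt0r_neq0 z0) (lt0r_neq0 zt0))
    (is_derive_cst (h t) z 1).
  by move=> dM; apply: (trigger_derive dM); rewrite mulr0 add0r mulrC.
have pF (z t : R) : 0 < z -> 0 < t -> partial1of2 F z t = kern a r.+1 N Q1 z t * h t.
  by move=> z0 t0; have dFz := dF z t z0 t0; rewrite partial1of2E derive_val.
have Iy : `](y / 2), (2 * y)[%classic y.
  by rewrite /= in_itv/=; apply/andP; split; move: y0; clear; lra.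
have iF (z : R) : `](y / 2), (2 * y)[%classic z -> mu.-integrable D (EFin \o F z).
  by move=> /in_I[z0 _ _]; exact: kern_integrable.
have derF (z t : R) : `](y / 2), (2 * y)[%classic z -> D t -> derivable (F ^~ t) z 1.
  by move=> /in_I[z0 _ _] /in_D t0; have dFz := dF z t z0 t0; exact: ex_derive.
have G0 t : 0 <= G t by rewrite mulr_ge0.
have leG (z t : R) : `](y / 2), (2 * y)[%classic z -> D t -> `|partial1of2 F z t| <= G t.
  move=> /in_I[z0 z1 z2] /in_D t0; rewrite pF// /G normrM (normrM (h t)) mulrCA mulrC.
  rewrite ler_wpM2l// (le_trans (hC z t _ t0)) ?z1//.
  by rewrite normfV (@ger0_norm _ (_ ^+ N))// exprn_ge0// addr_ge0// ltW.
have -> : \int[mu]_(t in D) (kern a r.+1 N Q1 y t * h t) =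
    \int[mu]_(t in D) partial1of2 F y t.
  by apply: eq_Rintegral => t; rewrite inE => /in_D t0; rewrite pF.
apply: DeriveDef.
  exact: (@derivable_under_integral _ _ _ mu _ _ (measurable_itv _)
    _ _ _ Iy iF derF G G0 iG leG).
by rewrite -derive1E (@differentiation_under_integral _ _ _ mu _ _
  (measurable_itv _) _ _ _ Iy iF derF G G0 iG leG).
Qed.
End kernel.

(** * Derivatives of the Gamma type operators *)

Section gamma_derivative.
Variable R : realType.
Implicit Types (y t : R) (g h : R -> R).
Local Notation mu := (@lebesgue_measure R).
Local Notation D := (`]0%R, +oo[%classic : set R).

Lemma eq_Rintegral_D g h : (forall t, 0 < t -> g t = h t) ->
  \int[mu]_(t in D) g t = \int[mu]_(t in D) h t.
Proof. by move=> gh; apply: eq_Rintegral => t; rewrite inE => /in_D/gh. Qed.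

Lemma RintegralZl_D g c : mu.-integrable D (EFin \o g) ->
  \int[mu]_(t in D) (c * g t) = c * \int[mu]_(t in D) g t.
Proof. exact: (@RintegralZl _ _ _ mu D g c (measurable_itv _)). Qed.

Lemma wint_mul L N m h : (m + L <= N)%N -> wint L h -> wint N (fun t => t ^+ m * h t).
Proof.
move=> mLN ih.
have mu_ : measurable_fun D (fun t => t ^+ m * kern 0 0 N 1 1 t * (1 + t) ^+ L).
  apply: measurable_realfun.measurable_funM; last exact: measurable_1t.
  apply: measurable_realfun.measurable_funM; last exact: kern_measurable.
  exact: measurable_realfun.exprn_measurable.
apply: (eq_integrable_D _ (integrable_bounded_mul (C := 1) mu_ _ ih)) => t t0.
  have t1L : (1 + t) ^+ L != 0 by rewrite expf_neq0// gt_eqF// addr_gt0.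
  have t1N : (1 + t) ^+ N != 0 by rewrite expf_neq0// gt_eqF// addr_gt0.
  by rewrite kern1E; field; rewrite t1L t1N.
have t1 : 0 < 1 + t by rewrite addr_gt0.
rewrite kern1E ger0_norm; last first.
  by rewrite !mulr_ge0 ?invr_ge0 ?exprn_ge0// ltW.
rewrite mulrAC ler_pdivrMr ?exprn_gt0// mul1r.
have -> : N = (m + L + (N - (m + L)))%N by rewrite subnKC.
rewrite !exprD -[leLHS]mulr1; apply: ler_pM => //.
- by rewrite mulr_ge0 ?exprn_ge0// ltW.
- by rewrite ler_wpM2r ?exprn_ge0 ?(ltW t1)// lerXn2r ?nnegrE ?(ltW t0) ?(ltW t1)// lerDr.
- by rewrite exprn_ege1// lerDl ltW.
Qed.

Lemma wint_le L N h : (L <= N)%N -> wint L h -> wint N h.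
Proof.
move=> LN /(@wint_mul L N 0 h); rewrite add0n => /(_ LN).
by apply: eq_integrable_D => t _; rewrite expr0 mul1r.
Qed.

(** A primitive is (t / (y + t))^(p+1) / ((p + 1) y), which vanishes at 0 and tends to 1 / ((p + 1)
    y). The integral is stated in the extended reals because its finiteness is what later gives the
    integrability of the integrand. *)
Lemma beta_base p y : 0 < y ->
  (\int[mu]_(t in D) (kern 0 0 (p + 2) 1 y t * t ^+ p)%:E =
   ((p.+1%:R * y)^-1)%:E)%E.
Proof.
move=> y0; pose F t := (p.+1%:R * y)^-1 * (t / (y + t)) ^+ p.+1.
have p0 : p.+1%:R != 0 :> R by rewrite pnatr_eq0.
have dF t : 0 <= t -> is_derive t (1 : R) F (kern 0 0 (p + 2) 1 y t * t ^+ p).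
  move=> t0; have yt0 : y + t != 0 by rewrite gt_eqF// ltr_wpDr.
  have did : is_derive t (1 : R) (fun z : R => z) 1 by exact: is_derive_id.
  have dadd : is_derive t (1 : R) (fun z : R => y + z) 1.
    rewrite -[X in is_derive _ _ _ X]add0r.
    by apply: (@is_deriveD _ _ _ (cst y) id).
  have ds := is_derive1M did (@is_derive1V _ (fun z => y + z) _ _ yt0 dadd).
  have dsX : is_derive t (1 : R) (fun z => (z / (y + z)) ^+ p.+1)
     (p.+1%:R * (t / (y + t)) ^+ p * (y / (y + t) ^+ 2)).
    have dX := @is_deriveX _ _ (fun z : R => z / (y + z)) p.+1 t 1 _ ds.
    have eX : (fun z => (z / (y + z)) ^+ p.+1) = (fun z : R => z / (y + z)) ^+ p.+1.
      by apply/funext => z; rewrite fctE.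
    rewrite eX; apply: (trigger_derive dX); rewrite /GRing.scale /=.
    by congr (_ * _); field.
  have dall := is_derive1M (is_derive_cst (p.+1%:R * y)^-1 t 1) dsX.
  apply: (trigger_derive dall).
  rewrite kern1E mulr0 addr0 /cst/= exprD expr_div_n.
  have := expf_neq0 p yt0.
  rewrite invfM; move: (t ^+ p) ((y + t) ^+ p) (p.+1%:R) p0 => a b c c0 b0.
  by field; rewrite c0 yt0 b0 gt_eqF.
have FTC := @ge0_continuous_FTC2y R (fun t => kern 0 0 (p + 2) 1 y t * t ^+ p) F 0
  ((p.+1%:R * y)^-1).
have cf t : 0 <= t -> {for t, continuous (fun t => kern 0 0 (p + 2) 1 y t * t ^+ p)}.
  move=> t0; apply: cvgM; last exact: exprn_continuous.
  by apply: kern_continuous; rewrite gt_eqF// ltr_wpDr.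
have mf : measurable_fun D (fun t => kern 0 0 (p + 2) 1 y t * t ^+ p).
  apply: measurable_realfun.measurable_funM; first exact: kern_measurable.
  exact: measurable_realfun.exprn_measurable.
rewrite integral_itv_obnd_cbnd; last exact/measurable_realfun.measurable_EFinP.
rewrite FTC.
- by rewrite /F mul0r expr0n /= mulr0 sube0.
- move=> t t0; rewrite kern1E.
  by rewrite mulr_ge0 ?invr_ge0 ?exprn_ge0// addr_ge0// ltW.
- apply: continuous_in_subspaceT => t; rewrite inE/= in_itv/= andbT; exact: cf.
- rewrite /F -[X in _ --> X]mulr1; apply: cvgM; first exact: cvg_cst.
  rewrite -[X in _ --> X](expr1n _ p.+1).
  apply: (@continuous_cvg _ _ _ _ _ _ (fun z : R => z ^+ p.+1)).
    exact: exprn_continuous.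
  have -> : 1 = 1 - y * 0 :> R by rewrite mulr0 subr0.
  apply: (@cvg_trans _ ((1 - y * (y + t)^-1) @[t --> +oo])).
    apply: near_eq_cvg; near=> t.
    have t0 : 0 < t by near: t; exact: nbhs_pinfty_gt.
    by have : y + t != 0; [rewrite gt_eqF// addr_gt0|move=> ?; field].
  apply: cvgB; first exact: cvg_cst.
  apply: cvgM; first exact: cvg_cst.
  by apply/gtr0_cvgV0; [near=> t; rewrite addr_gt0|exact: cvg_addrl].
- by move=> t /ltW t0; have dFt := dF t t0; exact: ex_derive.
- have d0 := dF 0 (lexx _); apply: cvg_at_right_filter.
  by apply: differentiable_continuous; apply/derivable1_diffP; exact: ex_derive.
- by move=> t; rewrite in_itv/= andbT => /ltW t0; have dFt := dF t t0;
  rewrite derive1E derive_val.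
Unshelve. all: end_near. Qed.

Lemma wint_monomial j : wint (j + 2) (fun t => t ^+ j).
Proof.
have mf : measurable_fun D (fun t => kern 0 0 (j + 2) 1 1 t * t ^+ j).
  apply: measurable_realfun.measurable_funM; first exact: kern_measurable.
  exact: measurable_realfun.exprn_measurable.
have if_ : mu.-integrable D (EFin \o (fun t => kern 0 0 (j + 2) 1 1 t * t ^+ j)).
  apply/integrableP; split; first exact/measurable_realfun.measurable_EFinP.
  rewrite (@eq_integral _ _ R mu D (fun t => (kern 0 0 (j + 2) 1 1 t * t ^+ j)%:E)).
    by rewrite beta_base// ltry.
  move=> t; rewrite inE => /in_D t0; rewrite /= ger0_norm//.
  rewrite kern1E.
  by rewrite mulr_ge0 ?invr_ge0 ?exprn_ge0 ?addr_ge0// ltW.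
apply: eq_integrable_D if_ => t _.
by rewrite kern1E mulrC.
Qed.

(* Induction on q: differentiating the identity in y raises q by one. *)
Lemma beta_integral p q y : 0 < y ->
  \int[mu]_(t in D) (t ^+ p / (y + t) ^+ (p + q + 2)) =
  (p`!)%:R * (q`!)%:R / ((p + q + 1)`!)%:R / y ^+ q.+1.
Proof.
rewrite (eq_Rintegral_D (h := fun t => kern 0 0 (p + q + 2) 1 y t * t ^+ p)); last first.
  by move=> t _; rewrite kern1E mulrC.
elim: q y => [|q ih] y y0.
  rewrite addn0 /Rintegral beta_base//= addn1 factS natrM fact0 mulr1 expr1 invfM.
  have := factR_neq0 R p; have : p.+1%:R != 0 :> R by rewrite pnatr_eq0.
  move: (p.+1%:R) (p`!%:R) => a b a0 b0.
  by field; rewrite a0 b0 gt_eqF.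
set N := (p + q + 2)%N in ih *.
have wN : wint N (fun t => t ^+ p).
  by apply: wint_le (wint_monomial p); rewrite /N; lia.
have dint := is_derive_Rint_kern 0 0 1 y0 wN.
set c := (p`!)%:R * (q`!)%:R / ((p + q + 1)`!)%:R in ih.
have did : is_derive y (1 : R) (fun z : R => z) 1 by exact: is_derive_id.
have yn0 : y != 0 by rewrite gt_eqF.
have dX := @is_derive1X _ (fun z => z) q.+1 _ _ yn0 did.
have dV := @is_derive1V _ (fun z => z ^+ q.+1) _ _ (expf_neq0 _ yn0) dX.
have dc := is_derive1M (is_derive_cst c y 1) dV.
have near_ih : \forall z \near y, cst c z / z ^+ q.+1 =
    \int[mu]_(t in D) (kern 0 0 N 1 z t * t ^+ p).
  by apply: filterS (lt_nbhsr y0) => z z0; rewrite ih.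
have dc' := near_eq_is_derive near_ih dc.
have := @derive_val _ _ _ _ _ _ _ dc'; rewrite (@derive_val _ _ _ _ _ _ _ dint).
rewrite (eq_Rintegral_D (h := fun t => - N%:R * (kern 0 0 N.+1 1 y t * t ^+ p))).
  rewrite RintegralZl_D; last first.
    by apply: kern_integrable => //; apply: wint_le wN; exact: leqnSn.
  rewrite (_ : N.+1 = p + q.+1 + 2)%N; last by rewrite /N; lia.
  move=> e; have N0 : N%:R != 0 :> R by rewrite pnatr_eq0 /N; lia.
  apply: (mulfI (_ : - N%:R != 0)); first by rewrite oppr_eq0.
  rewrite e /cst mulr0 addr0 /c (_ : p + q.+1 + 1 = (p + q + 1).+1)%N; last lia.
  rewrite !factS !natrM (_ : (p + q + 1).+1 = N)%N; last by rewrite /N; lia.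
  have := factR_neq0 R (p + q + 1); have := expf_neq0 q.+1 yn0.
  rewrite [y ^+ q.+2]exprS; move: (y ^+ q.+1) => yq yq0 ?.
  by field; apply/and4P.
move=> t t0; rewrite kern1E /kern !expr0 !hornerE/= derivC hornerC expr1 !exprS.
have yt0 : y + t != 0 by rewrite gt_eqF// addr_gt0.
have := expf_neq0 N yt0; move: ((y + t) ^+ N) => ytN ytN0.
by field; rewrite yn0 yt0 ytN0.
Qed.

Definition gamma_deriv n k r g y :=
  gamma_cst R n k * \int[mu]_(t in D)
    (kern n.+1 r (2 * n - k + 2) (kernel_poly R n.+1 (2 * n - k + 2) r) y t *
     (t ^+ (n - k) * g t)).

(** The induction runs over all positive y at once: the next derivative at y depends on the previous
    one in a neighbourhood. The side condition leaves room for t^(n-k) g under the weight of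
    exponent 2n - k + 2. *)
Lemma gammaM_derive1n n k r L g y : (n - k + L <= 2 * n - k + 2)%N ->
  wint L g -> 0 < y -> (gammaM n k g)^`(r)%classic y = gamma_deriv n k r g y.
Proof.
move=> nkL ig; have {}ig := wint_mul nkL ig.
elim: r y => [|r ih] y y0.
  rewrite derive1n0 /gammaM /gamma_deriv /gamma_cst.
  have -> : \int[mu]_(t in D) (kern n.+1 0 (2 * n - k + 2)
      (kernel_poly R n.+1 (2 * n - k + 2) 0) y t * (t ^+ (n - k) * g t)) =
    y ^+ n.+1 * \int[mu]_(t in D) (t ^+ (n - k) / (y + t) ^+ (2 * n - k + 2) * g t).
    have := kern_integrable 0 0 1 y0 ig => /(RintegralZl_D (y ^+ n.+1)).
    move=> e; apply: etrans (etrans e _).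
      apply: eq_Rintegral_D => t _.
      by rewrite kern1E /kern /= hornerC expr0 divr1 mulr1 -mulrA.
    by congr (_ * _); apply: eq_Rintegral_D => t _; rewrite kern1E mulrCA mulrA.
  by rewrite !mulrA; congr (_ * _); rewrite mulrAC.
rewrite derive1nS derive1E.
have near_ih : \forall z \near y, gamma_deriv n k r g z = (gammaM n k g)^`(r)%classic z.
  by apply: filterS (lt_nbhsr y0) => z z0; rewrite ih.
rewrite -(near_eq_derive (1 : R) near_ih).
have dint := is_derive_Rint_kern n.+1 r (kernel_poly R n.+1 (2 * n - k + 2) r) y0 ig.
have dG := is_derive1M (is_derive_cst (gamma_cst R n k) y 1) dint.
by have := @derive_val _ _ _ _ _ _ _ dG; rewrite mulr0 addr0.
Qed.

(** A Beta integral with exponents n - k + j and n - j; it converges because j <= n. *)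
Lemma gammaM_monomial n k j y : (k <= n)%N -> (j <= n)%N -> 0 < y ->
  gammaM n k (fun t => t ^+ j) y = bcoef R n k j * y ^+ j.
Proof.
move=> kn jn y0; rewrite /gammaM /bcoef.
rewrite (eq_Rintegral_D (h := fun t => t ^+ (n - k + j) /
    (y + t) ^+ (n - k + j + (n - j) + 2))); last first.
  move=> t t0; rewrite (_ : n - k + j + (n - j) + 2 = 2 * n - k + 2)%N; last lia.
  by rewrite mulrAC -exprD.
rewrite beta_integral// (_ : n - k + j + (n - j) + 1 = 2 * n - k + 1)%N; last lia.
have -> : n.+1 = ((n - j).+1 + j)%N by rewrite addSn subnK.
rewrite exprD; have := expf_neq0 (n - j).+1 (lt0r_neq0 y0).
have := factR_neq0 R (2 * n - k + 1); have := factR_neq0 R (n - k).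
have := factR_neq0 R n.
move: (y ^+ (n - j).+1) (y ^+ j) => a b n0 nk0 N0 a0.
by field; rewrite n0 nk0 N0 a0.
Qed.

(** The closed form of the operator on monomials is differentiated in place of the integral, so the
    polynomials [kernel_poly] never have to be computed. *)
Lemma gamma_deriv_monomial n k r j y : (k <= n)%N -> (j <= n)%N -> 0 < y ->
  gamma_deriv n k r (fun t => t ^+ j) y = bcoef R n k j * (y ^+ (j - r) *+ j ^_ r).
Proof.
move=> kn jn y0; have nkj : (n - k + (j + 2) <= 2 * n - k + 2)%N by lia.
rewrite -(gammaM_derive1n r nkj (wint_monomial j) y0).
elim: r y y0 => [|r ih] y y0.
  by rewrite derive1n0 subn0 ffactn0 gammaM_monomial.
rewrite derive1nS derive1E.
have near_ih : \forall z \near y, bcoef R n k j * (z ^+ (j - r) *+ j ^_ r) =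
    (gammaM n k (fun t => t ^+ j))^`(r)%classic z.
  by apply: filterS (lt_nbhsr y0) => z z0; rewrite ih.
rewrite -(near_eq_derive (1 : R) near_ih).
have dX := is_derive_poly ((bcoef R n k j *+ j ^_ r) *: 'X^(j - r)) y.
have eX : (fun z => bcoef R n k j * (z ^+ (j - r) *+ j ^_ r)) =
    horner ((bcoef R n k j *+ j ^_ r) *: 'X^(j - r)).
  by apply/funext => z; rewrite hornerZ hornerXn mulrnAr mulrnAl.
rewrite eX derive_val derivZ derivXn hornerZ hornerMn hornerXn.
by rewrite -subnS mulrnAl -mulrnAr -mulrnA mulnC -ffactnSr.
Qed.
End gamma_derivative.

(** * Moments of the kernel *)

Section moments.
Variable R : realType.
Implicit Types (x t : R) (g h : R -> R).
Local Notation mu := (@lebesgue_measure R).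
Local Notation D := (`]0%R, +oo[%classic : set R).

(* The square of (t - x) / (t + x), written in terms of x / (x + t). *)
Definition dev2 x t := (1 - 2 * (x / (x + t))) ^+ 2.

Lemma dev2_ge0 x t : 0 <= dev2 x t.
Proof. exact: sqr_ge0. Qed.

Lemma onem_dev2 x t : x + t != 0 -> 1 - dev2 x t = 4 * x * t / (x + t) ^+ 2.
Proof. by move=> xt0; rewrite /dev2; field. Qed.

Lemma dev2_le1 x t : 0 < x -> 0 < t -> dev2 x t <= 1.
Proof.
move=> x0 t0; have xt0 := addr_gt0 x0 t0.
rewrite -subr_ge0 onem_dev2 ?gt_eqF//.
by rewrite divr_ge0 ?mulr_ge0 ?exprn_ge0// ltW.
Qed.

(** In the variable s = x / (x + t) this is the density (s (1 - s))^p on the unit interval,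
    symmetric under exchange of s and 1 - s; it is the kernel for k = 0 without its constant. *)
Definition sym_kernel p x t := x ^+ p.+1 * t ^+ p / (x + t) ^+ (2 * p + 2).

Lemma sym_kernel_ge0 p x t : 0 < x -> 0 < t -> 0 <= sym_kernel p x t.
Proof.
move=> /ltW x0 /ltW t0.
by rewrite /sym_kernel divr_ge0 ?mulr_ge0 ?exprn_ge0// addr_ge0.
Qed.

Lemma sym_kernelS p x t : x + t != 0 ->
  sym_kernel p.+1 x t = sym_kernel p x t * ((1 - dev2 x t) / 4).
Proof.
move=> xt0; rewrite onem_dev2// /sym_kernel.
rewrite (_ : 2 * p.+1 + 2 = (2 * p + 2).+2)%N; last lia.
have := expf_neq0 (2 * p + 2) xt0; rewrite 2!(exprS (x + t)) (exprS x p.+1) (exprS t).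
move: (x ^+ p.+1) (t ^+ p) ((x + t) ^+ (2 * p + 2)) => a b c c0.
by field; rewrite c0 xt0.
Qed.

Lemma sym_kernel_integrable p m x : 0 < x ->
  mu.-integrable D (EFin \o (fun t => sym_kernel p x t * dev2 x t ^+ m)).
Proof.
move=> x0; have wp : wint (2 * p + 2) (fun t : R => t ^+ p).
  by apply: wint_le (wint_monomial R p); lia.
have := kern_integrable p.+1 0 ((1 - 2 *: 'X) ^+ 2 ^+ m) x0 wp.
apply: eq_integrable_D => t t0; rewrite /kern /sym_kernel /dev2 !hornerE/=.
by rewrite expr0 divr1; ring.
Qed.

(* sym_kernelS expresses moment m.+1 at p through moment m at p and p.+1. *)
Lemma sym_moment p m x : 0 < x ->
  \int[mu]_(t in D) (sym_kernel p x t * dev2 x t ^+ m) =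
  (p`!)%:R ^+ 2 / ((2 * p + 1)`!)%:R *
  \prod_(i < m) ((2 * i + 1)%:R / (2 * p + 3 + 2 * i)%:R).
Proof.
move=> x0; elim: m p => [|m ih] p.
  rewrite big_ord0 mulr1.
  rewrite (eq_Rintegral_D (h := fun t => x ^+ p.+1 * (t ^+ p / (x + t) ^+ (p + p + 2)))).
    rewrite RintegralZl_D.
      rewrite beta_integral// addnn mul2n; have := expf_neq0 p.+1 (lt0r_neq0 x0).
      have := factR_neq0 R (p.*2 + 1).
      by move: (x ^+ p.+1) => a *; field; apply/andP.
    have wp : wint (p + p + 2) (fun t : R => t ^+ p).
      by apply: wint_le (wint_monomial R p); lia.
    have := kern_integrable 0 0 1 x0 wp.
    by apply: eq_integrable_D => t _; rewrite kern1E mulrC.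
  by move=> t t0; rewrite /sym_kernel expr0 mulr1 mulrA addnn mul2n.
pose c m := \prod_(i < m) ((2 * i + 1)%:R / (2 * p + 3 + 2 * i)%:R) : R.
have -> : \int[mu]_(t in D) (sym_kernel p x t * dev2 x t ^+ m.+1) =
    \int[mu]_(t in D) (sym_kernel p x t * dev2 x t ^+ m) -
    4 * \int[mu]_(t in D) (sym_kernel p.+1 x t * dev2 x t ^+ m).
  rewrite -RintegralZl_D; last exact: sym_kernel_integrable.
  rewrite -(@RintegralB _ _ _ mu D _ _ (measurable_itv _)).
  - apply: eq_Rintegral_D => t t0.
    by rewrite sym_kernelS ?gt_eqF ?addr_gt0// exprS; field.
  - exact: sym_kernel_integrable.
  - apply: eq_integrable_D (integrable_bounded_mul (u := cst 4) (C := 4) _ _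
      (sym_kernel_integrable p.+1 m x0)) => // t t0.
    by rewrite ger0_norm.
rewrite !ih.
(* Replacing p by p + 1 shifts the denominators by one index, so only the first and the last of them
   survive in the quotient. *)
have cS : \prod_(i < m) ((2 * i + 1)%:R / (2 * p.+1 + 3 + 2 * i)%:R) =
    c m * (2 * p + 3)%:R / (2 * p + 3 + 2 * m)%:R.
  rewrite /c; elim: m {ih c} => [|m ih].
    by rewrite !big_ord0 muln0 addn0 mul1r divff// pnatr_eq0 addn3.
  rewrite !big_ord_recr/= ih (_ : 2 * p.+1 + 3 + 2 * m = 2 * p + 3 + 2 * m.+1)%N; last lia.
  have : (2 * p + 3 + 2 * m)%:R != 0 :> R by rewrite pnatr_eq0; lia.
  have : (2 * p + 3 + 2 * m.+1)%:R != 0 :> R by rewrite pnatr_eq0; lia.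
  move: (\prod__ _) (2 * p + 3 + 2 * m.+1)%:R (2 * p + 3 + 2 * m)%:R => a u v u0 v0.
  by field; rewrite u0 v0.
rewrite cS big_ord_recr/= -/(c m).
rewrite (_ : 2 * p.+1 + 1 = (2 * p + 1).+2)%N; last lia.
rewrite !factS !natrM; have := factR_neq0 R (2 * p + 1).
have e1 : (2 * p + 1).+1%:R = 2 * p%:R + 2 :> R.
  have -> : ((2 * p + 1).+1 = 2 * p + 2)%N by lia.
  by rewrite natrD natrM.
have e2 : (2 * p + 1).+2%:R = 2 * p%:R + 3 :> R.
  have -> : ((2 * p + 1).+2 = 2 * p + 3)%N by lia.
  by rewrite natrD natrM.
have e3 : (2 * p + 3 + 2 * m)%:R = 2 * p%:R + 3 + 2 * m%:R :> R.
  by rewrite natrD (natrD _ (2 * p)) !natrM.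
have e4 : (2 * p + 3)%:R = 2 * p%:R + 3 :> R by rewrite natrD natrM.
have e5 : (2 * m + 1)%:R = 2 * m%:R + 1 :> R by rewrite natrD natrM.
have e6 : p.+1%:R = p%:R + 1 :> R by rewrite -addn1 natrD.
rewrite e1 e2 e3 e4 e5 e6.
have p0 : 0 <= p%:R :> R by []; have m0 : 0 <= m%:R :> R by [].
move: (p`!%:R) ((2 * p + 1)`!%:R) (c m) (p%:R : R) (m%:R : R) p0 m0.
move=> a b d P M P0 M0 b0; field.
by rewrite b0 !gt_eqF//; lra.
Qed.
End moments.

(** * Moment and tail bounds for the kernel of the operator *)

Section kernel_bounds.
Variable R : realType.
Implicit Types (x t : R) (g h : R -> R).
Local Notation mu := (@lebesgue_measure R).
Local Notation D := (`]0%R, +oo[%classic : set R).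

Definition gamma_kernel n k x t :=
  gamma_cst R n k * (x ^+ n.+1 * t ^+ (n - k) / (x + t) ^+ (2 * n - k + 2)).

Lemma gamma_kernel_ge0 n k x t : 0 < x -> 0 < t -> 0 <= gamma_kernel n k x t.
Proof.
move=> x0 t0; rewrite mulr_ge0 ?gamma_cst_ge0// divr_ge0 ?mulr_ge0 ?exprn_ge0//.
- exact: ltW.
- exact: ltW.
- by rewrite addr_ge0 ?ltW.
Qed.

Lemma gamma_kernelE n k x t : (k <= n)%N -> x + t != 0 ->
  gamma_kernel n k x t =
  gamma_cst R n k * sym_kernel (n - k) x t * (x / (x + t)) ^+ k.
Proof.
move=> kn xt0; rewrite /gamma_kernel /sym_kernel -[RHS]mulrA; congr (_ * _).
rewrite expr_div_n (_ : 2 * n - k + 2 = 2 * (n - k) + 2 + k)%N; last lia.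
rewrite (_ : n.+1 = (n - k).+1 + k)%N; last lia.
rewrite (exprD x) (exprD (x + t)).
have := expf_neq0 k xt0; have := expf_neq0 (2 * (n - k) + 2) xt0.
move: (x ^+ _) (x ^+ _) (t ^+ _) ((x + t) ^+ _) ((x + t) ^+ _) => a b c d e.
by move=> d0 e0; field; rewrite d0 e0.
Qed.

(** The asymmetry of the kernel is the factor s^k, at most 1. Dropping it gives access to the
    explicit moments of [sym_kernel]. *)
Lemma gamma_kernel_le_sym n k x t : (k <= n)%N -> 0 < x -> 0 < t ->
  gamma_kernel n k x t <= gamma_cst R n k * sym_kernel (n - k) x t.
Proof.
move=> kn x0 t0; rewrite gamma_kernelE ?gt_eqF ?addr_gt0//.
have g0 := mulr_ge0 (gamma_cst_ge0 R n k) (sym_kernel_ge0 (n - k) x0 t0).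
by have /andP[? ?] := onem_itv01 x0 t0; rewrite ler_piMr// exprn_ile1.
Qed.

Lemma gamma_kernel_integrable n k m x : 0 < x -> (k <= n)%N ->
  mu.-integrable D (EFin \o (fun t => gamma_kernel n k x t * dev2 x t ^+ m)).
Proof.
move=> x0 kn; have wp : wint (2 * n - k + 2) (fun t : R => t ^+ (n - k)).
  by apply: wint_le (wint_monomial R (n - k)); lia.
have := kern_integrable n.+1 0 ((gamma_cst R n k)%:P * (1 - 2 *: 'X) ^+ 2 ^+ m) x0 wp.
apply: eq_integrable_D => t t0; rewrite /kern /gamma_kernel /dev2 !hornerE/=.
by rewrite expr0 divr1 /gamma_cst; ring.
Qed.

Lemma gamma_kernel_moment k m : exists2 M : R, 0 <= M &
  forall n x, 0 < x -> (k <= n)%N ->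
    n%:R ^+ m * \int[mu]_(t in D) (gamma_kernel n k x t * dev2 x t ^+ m) <= M.
Proof.
exists (2 ^+ k * \prod_(i < m) ((2 * i + 1)%:R * k.+1%:R)).
  by rewrite mulr_ge0 ?exprn_ge0// prodr_ge0.
move=> n x x0 kn; set p := (n - k)%N.
have le_int : \int[mu]_(t in D) (gamma_kernel n k x t * dev2 x t ^+ m) <=
    gamma_cst R n k * \int[mu]_(t in D) (sym_kernel p x t * dev2 x t ^+ m).
  rewrite -RintegralZl_D; last exact: sym_kernel_integrable.
  apply: (@le_Rintegral _ _ _ mu D _ _ (measurable_itv _)).
  - exact: gamma_kernel_integrable.
  - apply: eq_integrable_D (integrable_bounded_mul (u := cst (gamma_cst R n k))
      (C := gamma_cst R n k) _ _ (sym_kernel_integrable p m x0)) => // t t0.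
    by rewrite ger0_norm ?gamma_cst_ge0.
  - move=> t /in_D t0; rewrite [leRHS]mulrA ler_wpM2r ?(exprn_ge0 _ (dev2_ge0 x t))//.
    exact: gamma_kernel_le_sym.
rewrite (le_trans (ler_wpM2l _ le_int)) ?exprn_ge0// sym_moment//.
rewrite mulrCA [X in _ * X]mulrCA mulrA.
apply: ler_pM; rewrite ?mulr_ge0 ?gamma_cst_ge0 ?exprn_ge0 ?prodr_ge0 ?divr_ge0//.
  have nE : n = (p + k)%N by rewrite /p subnK.
  by rewrite nE; exact: gamma_cst_sym.
(* One factor n goes to each factor of the moment; n = p + k <= (k + 1) (2p + 3 + 2i) cancels the
   denominator uniformly in n. *)
have -> : n%:R ^+ m = \prod_(i < m) n%:R :> R by rewrite prodr_const card_ord.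
rewrite -big_split/=; apply: ler_prod => i _.
rewrite mulr_ge0 ?divr_ge0//= mulrCA ler_wpM2l//.
rewrite ler_pdivrMr ?ltr0n; last lia.
by rewrite -natrM ler_nat mulnDr mulnDr; nia.
Qed.

(* The kernel is comparable with n (1 - dev2) ^+ n, and v ^+ M (1 - v) ^+ n is
   at most of order n ^- M uniformly in v. *)
Lemma gamma_kernel_tail k L M x : 0 < x -> exists2 C : R, 0 <= C &
  forall n t, 0 < t -> (k + L <= n)%N -> (0 < n)%N ->
    gamma_kernel n k x t * dev2 x t ^+ M <=
    C * n%:R / n%:R ^+ M / (1 + t) ^+ L.
Proof.
move=> x0.
exists (3 * 2 ^+ k * 4 ^+ L * (M`!)%:R * (k + L).+1%:R ^+ M * (1 + x) ^+ L / x).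
  by rewrite divr_ge0 ?mulr_ge0 ?exprn_ge0 ?addr_ge0 ?(ltW x0).
move=> n t t0 kLn n0; have xt0 := addr_gt0 x0 t0.
(* Of the n - k = p + L powers of s (1 - s), p give (1 - v)^p for the decay in n, and L are kept
   back for the decay in t through s^L, their factors 1 - s being bounded by 1. *)
have [p nE] : exists p, n = (p + L + k)%N by exists (n - k - L)%N; lia.
have kn : (k <= n)%N by lia.
set s := x / (x + t); set v := dev2 x t.
have /andP[s0 s1] := onem_itv01 x0 t0.
have v0 : 0 <= v := dev2_ge0 x t.
have vM0 : 0 <= v ^+ M := exprn_ge0 M v0.
have v1 : v <= 1 := dev2_le1 x0 t0.
have hv : v ^+ M * (1 - v) ^+ p <= (M`!)%:R * (k + L).+1%:R ^+ M / n%:R ^+ M.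
  apply: le_trans (expr_mul_onem_le M p _) _; first by rewrite v0.
  rewrite -mulrA ler_wpM2l// -expr_div_n -exprVn lerXn2r ?nnegrE ?invr_ge0 ?divr_ge0//.
  by rewrite ler_pdivlMr ?ltr0n// mulrC ler_pdivrMr ?ltr0n// -natrM ler_nat nE; nia.
(* The 3 comes from 2n - k + 1 <= 3n, and 2^(2n-k) = 2^k 4^L 4^p; the factor 4^p cancels against the
   one in [hS], where s (1 - s) = (1 - v) / 4. *)
have hC : gamma_cst R n k <= 3 * n%:R * (2 ^+ k * 4 ^+ L * 4 ^+ p).
  apply: le_trans (gamma_cst_le R kn) _.
  have -> : (4 : R) = 2 ^+ 2 by rewrite expr2; ring.
  rewrite -!exprM -!exprD (_ : k + 2 * L + 2 * p = 2 * n - k)%N; last lia.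
  by rewrite ler_wpM2r ?exprn_ge0// -natrM ler_nat; lia.
have hS : sym_kernel (n - k) x t <= s ^+ L / x * (4 ^+ p)^-1 * (1 - v) ^+ p.
  have -> : (n - k = p + L)%N by lia.
  have -> : sym_kernel (p + L) x t = s ^+ 2 * (s ^+ L * (t / (x + t)) ^+ L) / x *
     (s * (t / (x + t))) ^+ p.
    rewrite /sym_kernel /s !exprMn !exprVn.
    rewrite (_ : 2 * (p + L) + 2 = (p + p + (L + L)).+2)%N; last lia.
    rewrite !exprS !exprD.
    have := expf_neq0 p (lt0r_neq0 xt0); have := expf_neq0 L (lt0r_neq0 xt0).
    have := lt0r_neq0 xt0; have := lt0r_neq0 x0.
    move: (x ^+ p) (x ^+ L) (t ^+ p) (t ^+ L) ((x + t) ^+ p) ((x + t) ^+ L) (x + t).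
    by move=> a b c d e f h x_ h0 f0 e0; rewrite expr0 !mulr1; field; rewrite x_ h0 f0 e0.
  set u := t / (x + t).
  have u0 : 0 <= u by rewrite divr_ge0 ?(ltW t0) ?(ltW xt0).
  have u1 : u <= 1 by rewrite ler_pdivrMr// mul1r lerDr (ltW x0).
  have -> : s * u = (1 - v) / 4.
    by rewrite onem_dev2 ?gt_eqF// /s /u; field; rewrite gt_eqF.
  rewrite (expr_div_n (1 - v)).
  have -> : s ^+ 2 * (s ^+ L * u ^+ L) / x * ((1 - v) ^+ p / 4 ^+ p) =
    s ^+ 2 * u ^+ L * (s ^+ L / x * (4 ^+ p)^-1 * (1 - v) ^+ p) by ring.
  apply: ler_piMl.
    rewrite mulr_ge0 ?exprn_ge0 ?subr_ge0// mulr_ge0 ?invr_ge0 ?exprn_ge0//.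
    by rewrite divr_ge0 ?(exprn_ge0 _ s0) ?(ltW x0).
  have s2 : s ^+ 2 <= 1 by apply: exprn_ile1.
  have uL : u ^+ L <= 1 by apply: exprn_ile1.
  exact: (mulr_ile1 (exprn_ge0 2 s0) (exprn_ge0 L u0) s2 uL).
have hs : s ^+ L <= (1 + x) ^+ L / (1 + t) ^+ L.
  have t1 : 0 < 1 + t by rewrite addr_gt0.
  rewrite -expr_div_n lerXn2r ?nnegrE ?divr_ge0 ?addr_ge0 ?(ltW t0) ?(ltW x0)//.
  rewrite ler_pdivlMr// mulrAC ler_pdivrMr//.
  by have := ltW x0; have := ltW t0; nra.
have le1 : gamma_kernel n k x t * v ^+ M <= 3 * n%:R * (2 ^+ k * 4 ^+ L * 4 ^+ p) *
    (s ^+ L / x * (4 ^+ p)^-1 * (1 - v) ^+ p) * v ^+ M.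
  rewrite (ler_wpM2r vM0)// (le_trans (gamma_kernel_le_sym kn x0 t0))//.
  apply: ler_pM; [exact: gamma_cst_ge0|exact: sym_kernel_ge0|exact: hC|exact: hS].
apply: le_trans le1 _.
have p4 : 4 ^+ p != 0 :> R by rewrite expf_neq0.
have -> : 3 * n%:R * (2 ^+ k * 4 ^+ L * 4 ^+ p) *
    (s ^+ L / x * (4 ^+ p)^-1 * (1 - v) ^+ p) * v ^+ M =
  3 * 2 ^+ k * 4 ^+ L * n%:R / x * (s ^+ L * (v ^+ M * (1 - v) ^+ p)).
  by field; rewrite p4 gt_eqF.
have -> : 3 * 2 ^+ k * 4 ^+ L * M`!%:R * (k + L).+1%:R ^+ M * (1 + x) ^+ L / x *
    n%:R / n%:R ^+ M / (1 + t) ^+ L =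
  3 * 2 ^+ k * 4 ^+ L * n%:R / x * ((1 + x) ^+ L / (1 + t) ^+ L *
    (M`!%:R * (k + L).+1%:R ^+ M / n%:R ^+ M)) by ring.
rewrite ler_wpM2l ?divr_ge0 ?mulr_ge0 ?exprn_ge0 ?(ltW x0)//.
apply: ler_pM; rewrite ?(exprn_ge0 _ s0)// mulr_ge0// exprn_ge0//.
by rewrite subr_ge0.
Qed.
End kernel_bounds.

(** * The Taylor remainder *)

Section remainder.
Variable R : realType.
Implicit Types (x t : R) (g h : R -> R).
Local Notation mu := (@lebesgue_measure R).
Local Notation D := (`]0%R, +oo[%classic : set R).

Lemma onem2_ratio x t : x + t != 0 -> 1 - 2 * (x / (x + t)) = (t - x) / (x + t).
Proof. by move=> xt0; field. Qed.

(** With a = sqrt n and z = a w the left-hand side is z^2 (z + z^2)^r: the r + 2 powers of w absorb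
    n and the whole Lorentz factor. It is at most 2^r for z <= 1 and 2^r z^(2r+2) otherwise, so
    moments 0 and r + 1 suffice. *)
Lemma scaled_deviation_le (a w : R) r : 0 <= a -> 0 <= w ->
  a ^+ 2 * (a + a ^+ 2 * w) ^+ r * w ^+ r.+2 <=
  2 ^+ r * (1 + (a ^+ 2) ^+ r.+1 * (w ^+ 2) ^+ r.+1).
Proof.
move=> a0 w0; set z := a * w; have z0 : 0 <= z by rewrite mulr_ge0.
have -> : (a ^+ 2) ^+ r.+1 * (w ^+ 2) ^+ r.+1 = (z ^+ 2) ^+ r.+1.
  by rewrite -!exprMn.
have -> : a ^+ 2 * (a + a ^+ 2 * w) ^+ r * w ^+ r.+2 = z ^+ 2 * (z + z ^+ 2) ^+ r.
  rewrite (_ : w ^+ r.+2 = w ^+ 2 * w ^+ r); last by rewrite -exprD.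
  rewrite mulrACA -exprMn -exprMn; congr (_ * _); congr (_ ^+ _).
  by rewrite /z; ring.
clearbody z; have [z1|/ltW z1] := leP z 1.
  rewrite mulrC; apply: ler_pM; rewrite ?exprn_ge0 ?addr_ge0 ?sqr_ge0//.
    rewrite lerXn2r ?nnegrE ?addr_ge0 ?sqr_ge0//.
    by have : z ^+ 2 <= 1 by [apply: exprn_ile1]; lra.
  rewrite (@le_trans _ _ 1) ?exprn_ile1// lerDl exprn_ge0// sqr_ge0//.
apply: (@le_trans _ _ (z ^+ 2 * (2 * z ^+ 2) ^+ r)).
  rewrite ler_wpM2l ?sqr_ge0// lerXn2r ?nnegrE ?addr_ge0 ?mulr_ge0 ?sqr_ge0//.
  by have : z <= z ^+ 2 by [rewrite expr2 ler_peMl]; lra.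
by rewrite exprMn mulrCA -exprS ler_wpM2l ?exprn_ge0// lerDr.
Qed.

Lemma remainder_near x t (C e n q gt : R) r :
  0 < x -> 0 < t -> `|t - x| <= x -> 0 <= C -> 0 <= e -> 0 <= n ->
  `|q| <= C * (Num.sqrt n + n * `|1 - 2 * (x / (x + t))|) ^+ r ->
  `|gt| <= e * `|t - x| ^+ r.+2 ->
  n * `|q| * `|gt| <=
    C * (3 * x) ^+ r.+2 * 2 ^+ r * e * (1 + n ^+ r.+1 * dev2 x t ^+ r.+1).
Proof.
move=> x0 t0 txx C0 e0 n0 hq hg; have xt0 := addr_gt0 x0 t0.
set w := `|1 - 2 * (x / (x + t))| in hq *.
(* Near x the deviations t - x and w are comparable: t <= 2 x gives x + t <= 3 x, the source of the
   constant (3 x)^(r+2). *)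
have txw : `|t - x| = (x + t) * w.
  rewrite /w onem2_ratio ?gt_eqF// normrM normfV (gtr0_norm xt0).
  by rewrite mulrC divfK// gt_eqF.
have dw : dev2 x t = w ^+ 2 by rewrite /dev2 /w real_normK// num_real.
have w0 : 0 <= w := normr_ge0 _.
have xt3 : x + t <= 3 * x.
  by move: txx; rewrite ler_norml => /andP[_]; lra.
have hg' : `|gt| <= e * ((3 * x) ^+ r.+2 * w ^+ r.+2).
  apply: le_trans hg _; rewrite ler_wpM2l// txw -exprMn.
  rewrite lerXn2r ?nnegrE ?mulr_ge0 ?(ltW xt0)//; first by rewrite ltW.
  by rewrite ler_wpM2r.
apply: (@le_trans _ _ (n * (C * (Num.sqrt n + n * w) ^+ r) *
    (e * ((3 * x) ^+ r.+2 * w ^+ r.+2)))).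
  apply: ler_pM; rewrite ?mulr_ge0//.
  by rewrite ler_wpM2l.
have := @scaled_deviation_le (Num.sqrt n) w r (sqrtr_ge0 _) w0.
rewrite sqr_sqrtr// dw => h.
have p0 : 0 <= C * (3 * x) ^+ r.+2 * e.
  have x3 : 0 <= 3 * x by rewrite mulr_ge0// ltW.
  by rewrite mulr_ge0// mulr_ge0// exprn_ge0.
have := ler_wpM2l p0 h; congr (_ <= _); ring.
Qed.

(** Away from x, |w| is at least d / (2 x + d), so a power of the quotient can be inserted at will,
    while the Lorentz factor is at most (2 n)^r. The exponent r + 3 pays for n^(r+1) here and for
    the n in [gamma_kernel_tail], and leaves 1 / n. *)
Lemma kernel_far_le x t (C d q : R) n r :
  0 < x -> 0 < t -> 0 < d -> d <= `|t - x| -> 0 <= C -> (0 < n)%N ->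
  `|q| <= C * (Num.sqrt n%:R + n%:R * `|1 - 2 * (x / (x + t))|) ^+ r ->
  n%:R * `|q| <= C * 2 ^+ r * n%:R ^+ r.+1 /
    ((d / (2 * x + d)) ^+ 2) ^+ r.+3 * dev2 x t ^+ r.+3.
Proof.
move=> x0 t0 d0 dtx C0 n0 hq; have xt0 := addr_gt0 x0 t0.
set w := `|1 - 2 * (x / (x + t))| in hq *.
set om := d / (2 * x + d).
have dw : dev2 x t = w ^+ 2 by rewrite /dev2 /w real_normK// num_real.
have xd0 : 0 < 2 * x + d by rewrite addr_gt0// mulr_gt0.
have om0 : 0 < om by rewrite divr_gt0.
have w0 : 0 <= w := normr_ge0 _.
have omw : om <= w.
  rewrite /w onem2_ratio ?gt_eqF// normrM normfV (gtr0_norm xt0).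
  rewrite ler_pdivrMr// mulrAC ler_pdivlMr//.
  have xt : x + t <= 2 * x + `|t - x| by have := ler_norm (t - x); lra.
  rewrite mulrDr; have : d * (x + t) <= d * (2 * x + `|t - x|) by rewrite ler_wpM2l// ltW.
  have : d * (2 * x) <= `|t - x| * (2 * x) by rewrite ler_wpM2r// mulr_ge0// ltW.
  lra.
have w1 : w <= 1.
  have : w ^+ 2 <= 1 by rewrite -dw; exact: dev2_le1.
  by rewrite expr_le1.
have n1 : 1 <= n%:R :> R by rewrite ler1n.
have sq : Num.sqrt n%:R <= n%:R :> R.
  rewrite -[leRHS]sqr_sqrtr// expr2 ler_peMl ?sqrtr_ge0//.
  by have := @ler_wsqrtr R 1 n%:R; rewrite sqrtr1 => /(_ n1).
have hq' : `|q| <= C * (2 * n%:R) ^+ r.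
  apply: le_trans hq _; rewrite ler_wpM2l//
    lerXn2r ?nnegrE ?addr_ge0 ?mulr_ge0 ?sqrtr_ge0//.
  have : n%:R * w <= n%:R by rewrite ler_piMr.
  lra.
have om2 : 0 < (om ^+ 2) ^+ r.+3 by rewrite exprn_gt0// exprn_gt0.
apply: (@le_trans _ _ (C * 2 ^+ r * n%:R ^+ r.+1)).
  by have := ler_wpM2l (ler0n R n) hq'; rewrite exprMn exprS; congr (_ <= _); ring.
rewrite -[leRHS]mulrA ler_peMr ?mulr_ge0 ?exprn_ge0//.
rewrite mulrC ler_pdivlMr// mul1r dw lerXn2r ?nnegrE ?exprn_ge0 ?(ltW om0)//.
by rewrite lerXn2r ?nnegrE ?(ltW om0).
Qed.
End remainder.

(** * The contribution of the Taylor remainder vanishes *)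

Section remainder_limit.
Variable R : realType.
Implicit Types (x t : R) (g h : R -> R).
Local Notation mu := (@lebesgue_measure R).
Local Notation D := (`]0%R, +oo[%classic : set R).

Lemma kernel_weight_le n k L : (k + L <= n)%N -> (n - k + L <= 2 * n - k + 2)%N.
Proof. by lia. Qed.

Lemma gamma_kern_norm n k r (Q : {poly R}) g x t : 0 < x -> 0 < t ->
  `|gamma_cst R n k * (kern n.+1 r (2 * n - k + 2) Q x t * (t ^+ (n - k) * g t))| =
  (x ^+ r)^-1 * (gamma_kernel n k x t * (`|Q.[x / (x + t)]| * `|g t|)).
Proof.
move=> x0 t0; rewrite /kern.
have -> : gamma_cst R n k * (x ^+ n.+1 / x ^+ r / (x + t) ^+ (2 * n - k + 2) *
    Q.[x / (x + t)] * (t ^+ (n - k) * g t)) =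
  (x ^+ r)^-1 * gamma_kernel n k x t * (Q.[x / (x + t)] * g t).
  by rewrite /gamma_kernel; ring.
have gk0 : 0 <= (x ^+ r)^-1 * gamma_kernel n k x t.
  by apply: mulr_ge0; [rewrite invr_ge0 exprn_ge0// ltW|exact: gamma_kernel_ge0].
by rewrite normrM (normrM Q.[_]) (ger0_norm gk0) -mulrA.
Qed.

Lemma gamma_deriv_remainder k r L g x : 0 < x -> wint L g ->
  (forall e, 0 < e -> \forall t \near x, `|g t| <= e * `|t - x| ^+ r.+2) ->
  n%:R * gamma_deriv n k r g x @[n --> \oo] --> (0 : R).
Proof.
move=> x0 ig small_g.
have [C C0 hC] := lorentz_bound (kernel_poly_lorentz R k r).
have [M0 M00 hM0] := gamma_kernel_moment R k 0.
have [M1 M10 hM1] := gamma_kernel_moment R k r.+1.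
have [T T0 hT] := gamma_kernel_tail k L r.+3 x0.
pose A := (x ^+ r)^-1 * (C * (3 * x) ^+ r.+2 * 2 ^+ r).
have A0 : 0 <= A.
  have x3 : 0 <= 3 * x by rewrite mulr_ge0// ltW.
  apply: mulr_ge0; first by rewrite invr_ge0 exprn_ge0// ltW.
  by rewrite mulr_ge0 ?exprn_ge0// mulr_ge0 ?exprn_ge0.
apply/cvgr0Pnorm_le => e e0.
(* Chosen so that the near part contributes at most e / 2; the added 1 keeps the denominator
   positive. *)
pose e' := e / 2 / (A * (M0 + M1) + 1).
have AM0 : 0 <= A * (M0 + M1) by rewrite mulr_ge0// addr_ge0.
have e'0 : 0 < e' by rewrite !divr_gt0// ltr_wpDl.
have [d0 /= d00 hd0] := small_g _ e'0.
(* The cap at x provides the condition |t - x| <= x of [remainder_near]. *)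
pose d := Num.min d0 x; have d_gt0 : 0 < d by rewrite lt_min d00.
pose B := (x ^+ r)^-1 * (C * 2 ^+ r / ((d / (2 * x + d)) ^+ 2) ^+ r.+3 * T).
have B0 : 0 <= B.
  have dd : 0 <= d / (2 * x + d)
    by rewrite divr_ge0 ?addr_ge0 ?mulr_ge0 ?(ltW x0) ?(ltW d_gt0).
  apply: mulr_ge0; first by rewrite invr_ge0 exprn_ge0// ltW.
  apply: mulr_ge0 => //; apply: divr_ge0; first by rewrite mulr_ge0 ?exprn_ge0.
  exact: exprn_ge0 (exprn_ge0 _ dd).
pose G t := `|g t / (1 + t) ^+ L|.
have iG : mu.-integrable D (EFin \o G) := integrable_norm ig.
pose I := \int[mu]_(t in D) G t.
have I0 : 0 <= I by apply: Rintegral_ge0 => t _; exact: normr_ge0.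
near=> n.
have kLn : (k + L <= n)%N by near: n; exact: nbhs_infty_ge.
have n_gt0 : (0 < n)%N by near: n; exact: nbhs_infty_gt.
have kn : (k <= n)%N := leq_trans (leq_addr _ _) kLn.
have Bn : B * I / n%:R <= e / 2.
  have : B * I / (e / 2) <= n%:R by near: n; exact: nbhs_infty_ger.
  by rewrite !ler_pdivrMr ?ltr0n ?divr_gt0// [n%:R * _]mulrC.
set Q := kernel_poly R n.+1 (2 * n - k + 2) r.
pose F t := gamma_cst R n k *
  (kern n.+1 r (2 * n - k + 2) Q x t * (t ^+ (n - k) * g t)).
have wg : wint (2 * n - k + 2) (fun t => t ^+ (n - k) * g t).
  exact: wint_mul (kernel_weight_le kLn) ig.
have ik := kern_integrable n.+1 r Q x0 wg.
have iZ c (h : R -> R) : mu.-integrable D (EFin \o h) ->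
    mu.-integrable D (EFin \o (fun t => c * h t)).
  by move=> ih; apply: (@integrable_bounded_mul _ (cst c) h `|c|).
have iF1 : mu.-integrable D (EFin \o F).
  exact: (iZ (gamma_cst R n k) _ ik).
have iF : mu.-integrable D (EFin \o (fun t => n%:R * F t)).
  exact: (iZ n%:R _ iF1).
have -> : n%:R * gamma_deriv n k r g x = \int[mu]_(t in D) (n%:R * F t).
  by rewrite (RintegralZl_D _ iF1) (RintegralZl_D _ ik).
pose K m t := gamma_kernel n k x t * dev2 x t ^+ m.
have iK m : mu.-integrable D (EFin \o K m) by exact: gamma_kernel_integrable.
(* One majorant for the whole half-line: the first two terms cover |t - x| < d, the last one covers
   the rest. All terms are nonnegative, so the integral need not be split. *)
pose U t := A * e' * K 0 t + (A * e' * n%:R ^+ r.+1 * K r.+1 t + B / n%:R * G t).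
have iD (h1 h2 : R -> R) : mu.-integrable D (EFin \o h1) ->
    mu.-integrable D (EFin \o h2) ->
    mu.-integrable D (EFin \o (fun t => h1 t + h2 t)).
  exact: (@integrableD _ _ _ mu D (measurable_itv _)).
have RD := @RintegralD _ _ _ mu D _ _ (measurable_itv _).
have iU : mu.-integrable D (EFin \o U).
  by apply: (iD _ _ (iZ _ _ (iK 0)) (iD _ _ (iZ _ _ (iK _)) (iZ _ _ iG))).
have intU : \int[mu]_(t in D) U t = A * e' * \int[mu]_(t in D) K 0 t +
    (A * e' * n%:R ^+ r.+1 * \int[mu]_(t in D) K r.+1 t + B / n%:R * I).
  rewrite /U RD ?RD ?RintegralZl_D//; by [exact: iZ | apply: iD; exact: iZ].
have leU : \int[mu]_(t in D) U t <= e.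
  rewrite intU.
  have h0 := hM0 n x x0 kn; rewrite expr0 mul1r -/(K 0) in h0.
  have h1 := hM1 n x x0 kn; rewrite -/(K r.+1) in h1.
  have Ae0 : 0 <= A * e' by rewrite mulr_ge0// ltW.
  have := ler_wpM2l Ae0 h0; have := ler_wpM2l Ae0 h1; move: Bn.
  have : A * e' * (M0 + M1) <= e / 2.
    rewrite /e' mulrAC mulrA ler_pdivrMr ?ltr_wpDl//.
    by rewrite mulrC ler_wpM2l ?divr_ge0 ?(ltW e0)// lerDl.
  rewrite mulrDr mulrAC !mulrA; lra.
apply: le_trans leU; apply: (le_trans (le_normr_Rintegral _ _)) => //.
apply: (@le_Rintegral _ _ _ mu D _ _ (measurable_itv _)) => //.
  exact: integrable_norm.
move=> t /in_D t0.
have t1 : 0 < 1 + t by rewrite addr_gt0.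
have GE : G t = `|g t| / (1 + t) ^+ L.
  by rewrite /G normrM normfV (@ger0_norm _ (_ ^+ L))// exprn_ge0// ltW.
have k0 := gamma_kernel_ge0 n k x0 t0.
have xr0 : 0 <= (x ^+ r)^-1 by rewrite invr_ge0 exprn_ge0// ltW.
have K0 m : 0 <= K m t.
  by apply: mulr_ge0 => //; apply: exprn_ge0; exact: dev2_ge0.
have Ae0 : 0 <= A * e' by rewrite mulr_ge0// ltW.
rewrite normrM (@ger0_norm _ n%:R)// gamma_kern_norm//.
have -> : n%:R * ((x ^+ r)^-1 * (gamma_kernel n k x t * (`|Q.[x / (x + t)]| * `|g t|))) =
  (x ^+ r)^-1 * gamma_kernel n k x t * (n%:R * `|Q.[x / (x + t)]| * `|g t|) by ring.
have hq := hC n (x / (x + t)) n_gt0 kn (onem_itv01 x0 t0).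
have [txd|dtx] := ltP `|t - x| d.
  have gt : `|g t| <= e' * `|t - x| ^+ r.+2.
    by apply: hd0; rewrite /= distrC (lt_le_trans txd)// ge_min lexx.
  have tx : `|t - x| <= x by rewrite (le_trans (ltW txd))// ge_min lexx orbT.
  have := remainder_near x0 t0 tx C0 (ltW e'0) (ler0n _ n) hq gt.
  move=> /(ler_wpM2l (mulr_ge0 xr0 k0)) /le_trans; apply.
  have -> : U t = (x ^+ r)^-1 * gamma_kernel n k x t * (C * (3 * x) ^+ r.+2 * 2 ^+ r * e' *
      (1 + n%:R ^+ r.+1 * dev2 x t ^+ r.+1)) + B / n%:R * G t.
    by rewrite /U /K /A expr0; ring.
  by rewrite lerDl; apply: mulr_ge0; [exact: divr_ge0|exact: normr_ge0].
have := kernel_far_le x0 t0 d_gt0 dtx C0 n_gt0 hq.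
set om := _ ^+ r.+3 => hfar.
have om0 : 0 <= om^-1.
  by rewrite invr_ge0; apply: exprn_ge0; apply: sqr_ge0.
have -> : (x ^+ r)^-1 * gamma_kernel n k x t * (n%:R * `|Q.[x / (x + t)]| * `|g t|) =
  (x ^+ r)^-1 * `|g t| * (gamma_kernel n k x t * (n%:R * `|Q.[x / (x + t)]|)) by ring.
have xg0 : 0 <= (x ^+ r)^-1 * `|g t| by rewrite mulr_ge0.
apply: le_trans (ler_wpM2l xg0 (ler_wpM2l k0 hfar)) _.
have c0 : 0 <= (x ^+ r)^-1 * `|g t| * (C * 2 ^+ r * n%:R ^+ r.+1 / om).
  have Cn0 : 0 <= C * 2 ^+ r * n%:R ^+ r.+1.
    by apply: mulr_ge0; [apply: mulr_ge0 => //; exact: exprn_ge0|exact: exprn_ge0].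
  exact: mulr_ge0 xg0 (mulr_ge0 Cn0 om0).
have -> : (x ^+ r)^-1 * `|g t| * (gamma_kernel n k x t *
    (C * 2 ^+ r * n%:R ^+ r.+1 / om * dev2 x t ^+ r.+3)) =
  (x ^+ r)^-1 * `|g t| * (C * 2 ^+ r * n%:R ^+ r.+1 / om) * K r.+3 t.
  by rewrite /K; ring.
apply: le_trans (ler_wpM2l c0 (hT n t t0 kLn n_gt0)) _.
have nn0 : n%:R != 0 :> R by rewrite pnatr_eq0 -lt0n.
have -> : (x ^+ r)^-1 * `|g t| * (C * 2 ^+ r * n%:R ^+ r.+1 / om) *
    (T * n%:R / n%:R ^+ r.+3 / (1 + t) ^+ L) = B / n%:R * G t.
  rewrite GE /B -/om (exprS _ r.+2) (exprS _ r.+1).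
  have a0 := expf_neq0 r.+1 nn0; set a := _ ^+ r.+1 in a0 *.
  set b := n%:R in nn0 *.
  transitivity ((x ^+ r)^-1 * `|g t| * (C * 2 ^+ r / om * T / (1 + t) ^+ L) *
    (a * b / (b * (b * a)))); first by ring.
  have -> : a * b / (b * (b * a)) = b^-1 by field; rewrite a0 nn0.
  by ring.
have xn0 : 0 <= A * e' * n%:R ^+ r.+1 by apply: mulr_ge0 => //; exact: exprn_ge0.
by rewrite /U addrA lerDr addr_ge0// mulr_ge0.
Unshelve. all: end_near. Qed.
End remainder_limit.

(** * Peano's form of Taylor's theorem *)

Section taylor.
Variable R : realType.
Implicit Types (x t : R) (f g : R -> R).

(** [nderivable] adds derivatives on the outside, whereas the induction for Taylor's theorem removes
    one on the inside by passing from g to its derivative. *)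
Lemma nderivable_derive1 m f x : nderivable m.+2 f x -> nderivable m.+1 (f^`())%classic x.
Proof.
elim: m x => [|m ih] x [near_f df].
  by split; [exact: filterS near_f|move: df; rewrite derive1n1 derive1n0].
split; last by rewrite -derive1Sn.
by apply: filterS near_f => y; exact: ih.
Qed.

Lemma nderivable_at m f x : nderivable m.+1 f x -> nderivable m f x.
Proof. by move=> [/nbhs_singleton]. Qed.

Lemma nderivable1 m f x : nderivable m.+1 f x -> derivable f x 1.
Proof.
elim: m => [[_]|m ih /nderivable_at]; last exact: ih.
by rewrite derive1n0.
Qed.

(** For m = 0 this is the definition of the derivative at x. Otherwise the induction hypothesis
    bounds the derivative of g, and the mean value theorem gives g t as that derivative at an
    intermediate c, times t - x. The derivative of top order is used at x alone. *)
Lemma peano_taylor0 m g x : nderivable m.+1 g x ->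
  (forall i, (i <= m.+1)%N -> g^`(i)%classic x = 0) ->
  forall e, 0 < e -> \forall t \near x, `|g t| <= e * `|t - x| ^+ m.+1.
Proof.
elim: m g => [|m ih] g dg g0 e e0.
  have gx0 : g x = 0 by have := g0 0%N isT; rewrite derive1n0.
  have dgx0 : 'D_1 g x = 0 by have := g0 1%N isT; rewrite derive1n1 derive1E.
  have : h^-1 *: ((g \o shift x) (h *: 1) - g x) @[h --> 0^'] --> 'D_1 g x.
    exact: (nderivable1 dg).
  rewrite dgx0 gx0 => /cvgr0Pnorm_le/(_ _ e0)[d /= d0 hd].
  exists d => //= t xtd; rewrite expr1.
  have [->|tx] := eqVneq t x; first by rewrite gx0 subrr normr0 mulr0.
  have := hd (t - x); rewrite /= sub0r normrN distrC => /(_ xtd).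
  rewrite subr_eq0 => /(_ tx); rewrite subr0 [_ *: 1]mulr1 subrK.
  by rewrite normrZ normfV ler_pdivrMl ?normr_gt0 ?subr_eq0// mulrC (distrC x).
have g'0 i : (i <= m.+1)%N -> (g^`())^`(i)%classic x = 0.
  by move=> im; rewrite -derive1Sn g0.
have := ih _ (nderivable_derive1 dg) g'0 e e0.
have : \forall t \near x, derivable g t 1.
  by case: dg => + _; apply: filterS => t; exact: nderivable1.
move=> near_d near_e; have [d /= d0 hd] := filterI near_d near_e.
exists d => //= t xtd; have gx0 : g x = 0 by have := g0 0%N isT; rewrite derive1n0.
have hmvt (u v : R) : u < v -> (forall z, u <= z <= v -> `|x - z| < d) ->
    exists2 c, u < c < v & g v - g u = g^`()%classic c * (v - u).
  move=> uv uvd; have dgz z : u <= z <= v -> derivable g z 1.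
    by move=> /uvd/hd[].
  have [||c] := @MVT R g (g^`())%classic u v uv.
  - move=> z; rewrite in_itv/= => /andP[uz zv].
    by apply: DeriveDef; [apply: dgz; rewrite !ltW|rewrite derive1E].
  - by apply: derivable_within_continuous => z; rewrite in_itv/=; exact: dgz.
  - by rewrite in_itv/= => ?; exists c.
have step c : `|x - c| < d -> `|x - c| <= `|x - t| ->
    `|g^`()%classic c * (t - x)| <= e * `|t - x| ^+ m.+2.
  move=> xc ct; rewrite normrM exprSr mulrA ler_wpM2r//.
  have [_ /le_trans] := hd c xc; apply; rewrite ler_wpM2l ?(ltW e0)//.
  by rewrite lerXn2r ?nnegrE// distrC (distrC t).
have [tx|xt|->] := ltgtP t x.
- move: xtd; rewrite /= (@gtr0_norm _ (x - t)) ?subr_gt0// => xtd.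
  have [|c /andP[tc cx]] := hmvt _ _ tx.
    by move=> z /andP[tz zx]; rewrite ger0_norm ?subr_ge0//; lra.
  rewrite gx0 sub0r => /(congr1 -%R); rewrite opprK -mulrN opprB => ->.
  by apply: step; rewrite !ger0_norm ?subr_ge0 ?(ltW tx) ?(ltW cx)//; lra.
- move: xtd; rewrite /= (@ltr0_norm _ (x - t)) ?subr_lt0// opprB => xtd.
  have [|c /andP[xc ct]] := hmvt _ _ xt.
    by move=> z /andP[xz zt]; rewrite ler0_norm ?subr_le0// opprB; lra.
  rewrite gx0 subr0 => ->.
  by apply: step; rewrite !ler0_norm ?subr_le0 ?(ltW xt) ?(ltW xc)// ?opprB; lra.
- by rewrite gx0 normr0; apply: mulr_ge0; rewrite ?exprn_ge0// ltW.
Qed.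

(** Existence and value are proved together: the derivative of order m + 1 at x requires the formula
    of order m on a neighbourhood. *)
Lemma nderivable_sub_poly m f (p : {poly R}) x : nderivable m f x ->
  nderivable m (fun t => f t - p.[t]) x /\
  forall i, (i <= m)%N ->
    (fun t => f t - p.[t])^`(i)%classic x = f^`(i)%classic x - (p^`(i)).[x].
Proof.
elim: m x => [|m ih] x.
  by move=> _; split=> // i; rewrite leqn0 => /eqP ->.
move=> [near_f df].
have near_ih : \forall y \near x, nderivable m (fun t => f t - p.[t]) y /\
    forall i, (i <= m)%N ->
      (fun t => f t - p.[t])^`(i)%classic y = f^`(i)%classic y - (p^`(i)).[y].
  exact: filterS near_f.
have near_eq : \forall y \near x, f^`(m)%classic y - p^`(m).[y] =
    (fun t => f t - p.[t])^`(m)%classic y.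
  by apply: filterS near_ih => y [_ /(_ m (leqnn m)) ->].
have dfp : is_derive x (1 : R) (fun t => f t - p.[t])^`(m)%classic
    (f^`(m.+1)%classic x - p^`(m.+1).[x]).
  apply: near_eq_is_derive near_eq _.
  have dp : is_derive x (1 : R) (horner p^`(m)) p^`(m.+1).[x].
    by rewrite derivnS; exact: is_derive_poly.
  have df' : is_derive x (1 : R) f^`(m)%classic (f^`(m.+1)%classic x).
    by apply: DeriveDef; [exact: df|rewrite derive1nS derive1E].
  exact: is_deriveB.
split; first by split; [by apply: filterS near_ih => y []|exact: ex_derive].
move=> i; rewrite leq_eqVlt => /orP[/eqP ->|].
  by rewrite derive1nS derive1E derive_val.
by rewrite ltnS; have [_] := nbhs_singleton near_ih; apply.
Qed.
End taylor.

(** * The limit *)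

Section voronovskaya.
Variable R : realType.
Implicit Types (x t : R) (f g : R -> R) (P : {poly R}).
Local Notation mu := (@lebesgue_measure R).
Local Notation D := (`]0%R, +oo[%classic : set R).

Lemma cvg_invn : (n%:R^-1 : R) @[n --> \oo] --> (0 : R).
Proof.
apply/gtr0_cvgV0; last exact: cvgr_idn.
by near=> n; rewrite ltr0n; near: n; exact: nbhs_infty_gt.
Unshelve. all: end_near. Qed.

Lemma cvg0_of_cvg_natmul (u : nat -> R) (l : R) :
  n%:R * u n @[n --> \oo] --> l -> u n @[n --> \oo] --> (0 : R).
Proof.
move=> ul; rewrite -(mulr0 l); apply: cvg_trans (cvgM ul cvg_invn).
apply: near_eq_cvg; near=> n.
have n0 : (0 < n)%N by near: n; exact: nbhs_infty_gt.
by rewrite /= mulrAC mulfV ?mul1r// pnatr_eq0 -lt0n.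
Unshelve. all: end_near. Qed.

Lemma bcoef_neq0 n k j : bcoef R n k j != 0.
Proof.
by rewrite /bcoef; apply: mulf_neq0; rewrite ?invr_eq0; apply: mulf_neq0; exact: factR_neq0.
Qed.

Lemma bcoefS n k j : (j < n)%N ->
  bcoef R n k j.+1 = bcoef R n k j * ((n - k + j).+1%:R / (n - j)%:R).
Proof.
move=> jn; rewrite /bcoef addnS factS natrM -(subnSK jn) factS natrM.
have : (n - j.+1).+1%:R != 0 :> R by rewrite pnatr_eq0.
have := factR_neq0 R n; have := factR_neq0 R (n - k).
move: ((n - j.+1).+1%:R : R) => a b0 c0 a0.
by field; rewrite a0 b0 c0.
Qed.

Lemma bcoef_expansion k j :
  n%:R * (bcoef R n k j - 1) @[n --> \oo] --> j%:R * (j%:R - k%:R : R).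
Proof.
elim: j => [|j ih].
  rewrite mul0r; apply: cvg_near_cst; near=> n.
  have d0 := mulf_neq0 (factR_neq0 R n) (factR_neq0 R (n - k)).
  by rewrite /bcoef subn0 addn0 divff// subrr mulr0.
(* This is n / (n - j). The ratio of consecutive coefficients in [bcoefS] is 1 + c q / n with c = 2j
   + 1 - k, and j (j - k) + c = (j + 1) (j + 1 - k). *)
pose q n : R := (1 - j%:R * n%:R^-1)^-1.
have cq : q n @[n --> \oo] --> (1 : R).
  rewrite -[X in _ --> X]invr1; apply: cvgV; first exact: oner_neq0.
  rewrite -[X in _ --> X]subr0 -(mulr0 j%:R).
  by apply: cvgB; [exact: cvg_cst|apply: cvgM; [exact: cvg_cst|exact: cvg_invn]].
pose c : R := 2 * j%:R + 1 - k%:R.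
have -> : j.+1%:R * (j.+1%:R - k%:R) = j%:R * (j%:R - k%:R) * (1 + c * 1 * 0) + c * 1 :> R.
  by rewrite -addn1 natrD /c; ring.
have ccq : c * q n @[n --> \oo] --> c * 1 by apply: cvgM cq; exact: cvg_cst.
have crho : 1 + c * q n * n%:R^-1 @[n --> \oo] --> 1 + c * 1 * 0.
  by apply: cvgD; [exact: cvg_cst|exact: cvgM ccq cvg_invn].
apply: cvg_trans (cvgD (cvgM ih crho) ccq).
apply: near_eq_cvg; near=> n.
have jn : (j < n)%N by near: n; exact: nbhs_infty_gt.
have kn : (k <= n)%N by near: n; exact: nbhs_infty_ge.
have n0 : n%:R != 0 :> R by rewrite pnatr_eq0; lia.
have nj0 : n%:R - j%:R != 0 :> R by rewrite -natrB ?(ltnW jn)// pnatr_eq0; lia.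
have e : (n - k + j).+1%:R = n%:R - k%:R + j%:R + 1 :> R.
  by rewrite -[(n - k + j).+1]addn1 natrD natrD natrB.
rewrite bcoefS// e natrB ?(ltnW jn)// !fctE /q /c /=.
by field; rewrite n0 nj0.
Unshelve. all: end_near. Qed.

(** The operator is diagonal on powers of t and not on powers of t - x, so the derivatives of the
    Taylor polynomial are needed in terms of its coefficients at 0. *)
Lemma horner_derivn P i x :
  P^`(i).[x] = \sum_(j < size P) P`_j * (x ^+ (j - i) *+ j ^_ i).
Proof.
rewrite -{1}[P]coefK poly_def linear_sum horner_sum; apply: eq_bigr => j _ /=.
by rewrite derivnZ derivnXn hornerZ hornerMn hornerXn.
Qed.

Lemma derivn_comp_subX P c i : (P \Po ('X - c%:P))^`(i) = P^`(i) \Po ('X - c%:P).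
Proof.
elim: i => [|i ih]; first by rewrite !derivn0.
by rewrite !derivnS ih deriv_comp derivXsubC mulr1.
Qed.

Definition taylor_poly (m : nat) f x : {poly R} :=
  (\poly_(i < m) (f^`(i)%classic x / (i`!)%:R)) \Po ('X - x%:P).

Lemma taylor_poly_derivn m f x i : (i < m)%N ->
  (taylor_poly m f x)^`(i).[x] = f^`(i)%classic x.
Proof.
move=> im; rewrite derivn_comp_subX horner_comp hornerXsubC subrr.
rewrite horner_coef0 coef_derivn addn0 coef_poly im ffactnn.
by rewrite -(mulr_natr (_ / _)) divfK// factR_neq0.
Qed.

Lemma wintZ L c g : wint L g -> wint L (fun t => c * g t).
Proof.
move=> ig; have := @integrable_bounded_mul _ (cst c) _ `|c| (measurable_cst _)
  (fun _ _ => lexx _) ig.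
by apply: eq_integrable_D => t _; rewrite mulrA.
Qed.

Lemma wintD L g1 g2 : wint L g1 -> wint L g2 -> wint L (fun t => g1 t + g2 t).
Proof.
move=> i1 i2; have := @integrableD _ _ _ mu D (measurable_itv _) _ _ i1 i2.
by apply: eq_integrable_D => t _; rewrite mulrDl.
Qed.

Lemma wint_sum (c : nat -> R) m L : (m < L)%N ->
  wint L (fun t => \sum_(j < m) c j * t ^+ j).
Proof.
elim: m => [|m ih] mL.
  rewrite /wint; apply: (@eq_integrable_D _ (cst 0)) => [t _|].
    by rewrite big_ord0 mul0r.
  exact: (@integrable0 _ _ _ mu).
have -> : (fun t => \sum_(j < m.+1) c j * t ^+ j) =
    (fun t => \sum_(j < m) c j * t ^+ j + c m * t ^+ m).
  by apply/funext => t; rewrite big_ord_recr.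
apply: wintD (ih (ltnW mL)) (wintZ _ _).
by apply: wint_le (wint_monomial R m); lia.
Qed.

Lemma gamma_derivD n k r L g1 g2 x : (k + L <= n)%N -> 0 < x ->
  wint L g1 -> wint L g2 ->
  gamma_deriv n k r (fun t => g1 t + g2 t) x =
  gamma_deriv n k r g1 x + gamma_deriv n k r g2 x.
Proof.
move=> kLn x0 i1 i2; rewrite /gamma_deriv -mulrDr; congr (_ * _).
have i1' := wint_mul (kernel_weight_le kLn) i1.
have i2' := wint_mul (kernel_weight_le kLn) i2.
have := @RintegralD _ _ _ mu D _ _ (measurable_itv _)
  (kern_integrable n.+1 r (kernel_poly R n.+1 (2 * n - k + 2) r) x0 i1')
  (kern_integrable n.+1 r (kernel_poly R n.+1 (2 * n - k + 2) r) x0 i2').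
by move=> <-; apply: eq_Rintegral_D => t _; rewrite -mulrDr -mulrDr.
Qed.

Lemma gamma_derivZ n k r L g c x : (k + L <= n)%N -> 0 < x -> wint L g ->
  gamma_deriv n k r (fun t => c * g t) x = c * gamma_deriv n k r g x.
Proof.
move=> kLn x0 ig; rewrite /gamma_deriv mulrCA; congr (_ * _).
have ig' := wint_mul (kernel_weight_le kLn) ig.
rewrite -RintegralZl_D; last exact: kern_integrable.
by apply: eq_Rintegral_D => t _; ring.
Qed.

Lemma gamma_deriv_sum n k r (c : nat -> R) m x : (k + m.+1 <= n)%N -> 0 < x ->
  gamma_deriv n k r (fun t => \sum_(j < m) c j * t ^+ j) x =
  \sum_(j < m) c j * (bcoef R n k j * (x ^+ (j - r) *+ j ^_ r)).
Proof.
move=> + x0; elim: m => [|m ih] kmn.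
  rewrite big_ord0 /gamma_deriv (eq_Rintegral_D (h := fun t => 0 * 0)).
    rewrite RintegralZl_D ?mul0r ?mulr0//; exact: (@integrable0 _ _ _ mu).
  by move=> t _; rewrite big_ord0 !mulr0.
have -> : (fun t => \sum_(j < m.+1) c j * t ^+ j) =
    (fun t => \sum_(j < m) c j * t ^+ j + c m * t ^+ m).
  by apply/funext => t; rewrite big_ord_recr.
have im : wint m.+2 (fun t : R => t ^+ m) by apply: wint_le (wint_monomial R m); lia.
rewrite (@gamma_derivD _ _ _ m.+2)//.
- rewrite (gamma_derivZ r (c m) kmn x0 im) gamma_deriv_monomial//; try lia.
  by rewrite big_ord_recr/= ih//; lia.
- exact: wint_sum.
- exact: wintZ.
Qed.

Lemma bcoef_inv_cvg k r : (bcoef R n k r)^-1 @[n --> \oo] --> (1 : R).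
Proof.
rewrite -[X in _ --> X]invr1; apply: cvgV; first exact: oner_neq0.
have h := cvg0_of_cvg_natmul (@bcoef_expansion k r).
rewrite -[X in _ --> X]add0r; apply: cvg_trans (cvgD h (cvg_cst (1 : R))).
by apply: near_eq_cvg; near=> n; rewrite fctE subrK.
Unshelve. all: end_near. Qed.

(** The difference of the two first-order terms, j (j - k) - r (r - k), factors as (j - r) (j + r -
    k). *)
Lemma bcoef_ratio_limit k j r :
  n%:R * (bcoef R n k j / bcoef R n k r - 1) @[n --> \oo] -->
    ((j%:R - r%:R) * (j%:R + r%:R - k%:R) : R).
Proof.
have cj := @bcoef_expansion k j; have cr := @bcoef_expansion k r.
rewrite (_ : (j%:R - r%:R) * _ =
  (j%:R * (j%:R - k%:R) - r%:R * (r%:R - k%:R)) * 1); last by ring.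
apply: cvg_trans (cvgM (cvgB cj cr) (@bcoef_inv_cvg k r)).
apply: near_eq_cvg; near=> n; rewrite !fctE /=.
have := bcoef_neq0 n k r; move: (bcoef R n k r) (bcoef R n k j) => a b a0.
by field.
Unshelve. all: end_near. Qed.

(** Split j + r - k as (2r - k + 1) + (j - r - 1): the factors j - r and j - r - 1 extend the
    falling factorial of length r to lengths r + 1 and r + 2. Where an exponent of x is truncated,
    the accompanying falling factorial is zero. *)
Lemma falling_limit_identity (k j r : nat) x :
  (x ^+ (j - r) *+ j ^_ r) * ((j%:R - r%:R) * (j%:R + r%:R - k%:R)) =
  (2 * r%:R - k%:R + 1) * x * (x ^+ (j - r.+1) *+ j ^_ r.+1) +
  x ^+ 2 * (x ^+ (j - r.+2) *+ j ^_ r.+2).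
Proof.
have [jr|rj] := ltnP j r.
  by rewrite !ffact_small ?mulr0n ?mul0r ?mulr0 ?addr0//; lia.
have [i ->] : exists i, j = (r + i)%N by exists (j - r)%N; lia.
have e1 : (r + i - r.+1 = i.-1)%N by lia.
have e2 : (r + i - r.+2 = i.-2)%N by lia.
rewrite !ffactnSr addKn e1 e2 natrD; set F := (r + i) ^_ r.
case: i {e1 e2} @F => [|[|i]] F /=.
- by rewrite !muln0 !mulr0n; ring.
- by rewrite muln0 muln1 mulr0n -(mulr_natr (x ^+ 1) F) -(mulr_natr (x ^+ 0) F); ring.
have i1 : i.+1%:R = i%:R + 1 :> R by rewrite natr1.
have i2 : i.+2%:R = i%:R + 2 :> R by rewrite -[i.+2]addn2 natrD.
rewrite -(mulr_natr _ F) -(mulr_natr _ (F * i.+2)) -(mulr_natr _ (F * i.+2 * i.+1)).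
rewrite !natrM i1 i2 (exprS x i.+1) (exprS x i).
move: (F%:R : R) (i%:R : R) (x ^+ i) => a b c; ring.
Qed.

End voronovskaya.

Theorem theorem1 (R : realType) (k r : nat) (f : R -> R) (x alpha : R)
  (k_gt0 : (0 < k)%N)
  (f_int : lebesgue_measure.-integrable `]0, +oo[ (EFin \o f))
  (x_gt0 : 0 < x)
  (f_der1 : nderivable r.+1 f x)
  (f_der2 : nderivable r.+2 f x)
  (alpha_gt0 : 0 < alpha)
  (f_der_infty : \forall t \near +oo, nderivable r f t)
  (f_growth : exists2 C : R, 0 < C &
     \forall t \near +oo, `|f^`(r)%classic t| <= C * `|t `^ alpha|) :
  (fun n : nat =>
     n%:R * ((bcoef R n k r)^-1 * (gammaM n k f)^`(r)%classic x
             - f^`(r)%classic x)) @ \oo -->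
  (2 * r%:R - k%:R + 1) * x * f^`(r.+1)%classic x +
  x ^+ 2 * f^`(r.+2)%classic x.
Proof.
pose P := taylor_poly r.+3 f x; pose m := size P.
pose g t := f t - P.[t]; pose L := (m.+1 + r)%N.
have PE i : (i < r.+3)%N -> f^`(i)%classic x = P^`(i).[x].
  by move=> ir; rewrite taylor_poly_derivn.
have hornerP t : P.[t] = \sum_(j < m) P`_j * t ^+ j by rewrite horner_coef.
have wf0 : wint 0 f.
  by apply: eq_integrable_D f_int => t _; rewrite expr0 divr1.
have wf : wint L f by exact: wint_le wf0.
have wP : wint L (fun t => \sum_(j < m) P`_j * t ^+ j).
  by apply: (wint_sum (fun j => P`_j)); rewrite /L; lia.
have wg : wint L g.
  apply: (eq_integrable_D _ (wintD wf (wintZ (-1) wP))) => t _.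
  by rewrite /g hornerP mulN1r.
have [dg gE] := nderivable_sub_poly P f_der2.
have g0 i : (i <= r.+2)%N -> g^`(i)%classic x = 0.
  by move=> ir; rewrite gE// PE// subrr.
have rem := @gamma_deriv_remainder R k r L g x x_gt0 wg (peano_taylor0 dg g0).
pose u (j n : nat) : R := n%:R * (bcoef R n k j / bcoef R n k r - 1).
pose l (j : nat) : R := (j%:R - r%:R) * (j%:R + r%:R - k%:R).
pose c (j : nat) : R := P`_j * (x ^+ (j - r) *+ j ^_ r).
have cu j : c j * u j n @[n --> \oo] --> c j * l j.
  by apply: cvgM; [exact: cvg_cst|exact: bcoef_ratio_limit].
have csum : \sum_(j < m) c j * u j n @[n --> \oo] --> \sum_(j < m) c j * l j.
  by apply: cvg_big => [|i _]; [exact: add_continuous|exact: cu].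
(* The limit is split as it is obtained: the sum comes from the Taylor polynomial, and 1 times 0
   from the inverse of b(n,k,r) times the remainder term. *)
have -> : (2 * r%:R - k%:R + 1) * x * f^`(r.+1)%classic x +
    x ^+ 2 * f^`(r.+2)%classic x = \sum_(j < m) c j * l j + 1 * 0.
  rewrite !PE// !horner_derivn mulr0 addr0 !mulr_sumr -big_split/=.
  apply: eq_bigr => j _; rewrite /c /l -[RHS]mulrA falling_limit_identity mulrDr.
  by congr (_ + _); rewrite mulrCA.
apply: cvg_trans (cvgD csum (cvgM (@bcoef_inv_cvg R k r) rem)).
apply: near_eq_cvg; near=> n.
have kLn : (k + L <= n)%N by near: n; exact: nbhs_infty_ge.
have kmn : (k + m.+1 <= n)%N by move: kLn; rewrite /L; lia.
rewrite (gammaM_derive1n r (kernel_weight_le kLn) wf x_gt0).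
have -> : gamma_deriv n k r f x = \sum_(j < m) bcoef R n k j * c j + gamma_deriv n k r g x.
  transitivity (gamma_deriv n k r (fun t => \sum_(j < m) P`_j * t ^+ j + g t) x).
    congr (gamma_deriv _ _ _ _ x); apply/funext => t.
    by rewrite /g hornerP addrC subrK.
  rewrite (gamma_derivD r kLn x_gt0 wP wg); congr (_ + _).
  rewrite (gamma_deriv_sum r (fun j => P`_j) kmn x_gt0).
  by apply: eq_bigr => j _; rewrite mulrCA.
rewrite (PE r (leq_addl 2 r.+1)) horner_derivn !fctE /=.
(* The sum of the [c j] is the r-th derivative of P at x, that is f^(r)(x), so the polynomial part
   with f^(r)(x) subtracted is a combination of the ratios in [u]. *)
have -> : \sum_(j < m) c j * u j n =
    n%:R * ((bcoef R n k r)^-1 * (\sum_(j < m) bcoef R n k j * c j) - \sum_(j < m) c j).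
  rewrite mulr_sumr -sumrB mulr_sumr; apply: eq_bigr => j _.
  by rewrite /u; ring.
by rewrite /c; ring.
Unshelve. all: end_near. Qed.
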